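(* All digraphs are finite directed graphs, with loops and parallel edges allowed. The Moves (S), (R), (O), (I), (C), (P), the spectra, and the phrases ''a move preserves / does not preserve the multiset of nonzero elements of a spectrum'' are as defined in the context. \textbf{A. (All finite digraphs.)} \begin{itemize} \item[(i)] Moves (S), (O), and (I) preserve the multiset of nonzero elements of the adjacency spectrum $\operatorname{Spec}_{\mathbf{A}}(D)$, while Moves (R), (C), and (P) do not. \item[(ii)] Moves (S), (O), and (I) preserve the multiset of nonzero elements of the line adjacency spectrum $\operatorname{Spec}_{\mathbf{L}}(D)$, while Moves (R), (C), and (P) do not. \item[(iii)] Move (S) preserves the multiset of nonzero elements of the binary adjacency spectrum $\operatorname{Spec}_{\mathbf{A}_b}(D)$, while Moves (R), (O), (I), (C), and (P) do not. \item[(iv)] Move (C) preserves the multisets of nonzero elements of the skew adjacency spectrum $\operatorname{Spec}_{\mathbf{S}}(D)$, the binary skew adjacency spectrum $\operatorname{Spec}_{\mathbf{S}_b}(D)$, the skew Laplace spectrum $\operatorname{Spec}_{\boldsymbol{\Delta}_S}(D)$, and the binary skew Laplace spectrum $\operatorname{Spec}_{\boldsymbol{\Delta}_{b,S}}(D)$, while, for each of these four spectra, each of the Moves (S), (R), (O), (I), and (P) does not. \item[(v)] For each of the following four spectra: the Laplace spectrum $\operatorname{Spec}_{\boldsymbol{\Delta}}(D)$, the symmetric adjacency spectrum $\operatorname{Spec}^{\mathcal{S}}_{\mathbf{A}}(D)$, the symmetric binary adjacency spectrum $\operatorname{Spec}^{\mathcal{S}}_{\mathbf{A}_b}(D)$,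 and the Hermitian adjacency spectrum $\operatorname{Spec}_{\mathbf{H}}(D)$, none of the Moves (S), (R), (O), (I), (C), (P) preserves the multiset of nonzero elements of that spectrum. \end{itemize} \textbf{B. (Strongly connected digraphs.)} If $D$ is a strongly connected finite digraph, then Moves (S) and (P) cannot be applied to $D$, so that only Moves (R), (O), (I), and (C) can be applied. The claims (i)--(v), restricted to the Moves (R), (O), (I), (C), remain true within the class of strongly connected finite digraphs. Furthermore, for each of the following four spectra, which are defined only for strongly connected digraphs: the normalized Laplace spectrum $\operatorname{Spec}_{\boldsymbol{\Delta}_N}(D)$, the binary normalized Laplace spectrum $\operatorname{Spec}_{\boldsymbol{\Delta}_{b,N}}(D)$, the combinatorial Laplace spectrum $\operatorname{Spec}_{\boldsymbol{\Delta}_C}(D)$, and the binary combinatorial Laplace spectrum $\operatorname{Spec}_{\boldsymbol{\Delta}_{b,C}}(D)$, none of the Moves (R), (O), (I), (C) preserves the multiset of nonzero elements of that spectrum within the class of strongly connected finite digraphs.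
   Context: \textbf{Digraphs.} A digraph $D=(V,E,r,s)$ consists of a set $V$ of vertices, a set $E$ of edges, and maps $s,r:E\to V$ (source and range). It is finite if $V$ and $E$ are finite. Loops ($r(e)=s(e)$) and parallel edges ($e\ne f$ with $s(e)=s(f)$, $r(e)=r(f)$) are allowed. A path of length $n$ is a sequence $(e_1,\dots,e_n)$ of edges with $r(e_i)=s(e_{i+1})$ for $1\le i<n$. A cycle is a nonempty path with $r(e_n)=s(e_1)$; it is vertex-simple if the $r(e_i)$ are pairwise distinct. A vertex-simple cycle $(e_1,\dots,e_n)$ has an exit if there are an $i$ and an edge $f\neq e_i$ with $s(f)=s(e_i)$. A return path is a cycle $(e_1,\dots,e_n)$ with $r(e_n)\ne r(e_i)$ for $1\le i<n$; a vertex $v$ supports it if $r(e_n)=v$. A source is a vertex $v$ with $r^{-1}(v)=\emptyset$; a sink is a vertex with $s^{-1}(v)=\emptyset$; a vertex is regular if $s^{-1}(v)$ is finite and nonempty. $D$ is strongly connected if for each pair of vertices $v,w$ there is a path from $v$ to $w$. The indegree and outdegree are $d^{in}_v=|r^{-1}(v)|$ and $d^{out}_v=|s^{-1}(v)|$; the binary indegree and outdegree are $d^{b,in}_v=|s(r^{-1}(v))|$ and $d^{b,out}_v=|r(s^{-1}(v))|$. The line digraph $\mathcal{L}(D)$ has vertex set $E$ and edge set $\{(e,f)\in E^2: r(e)=s(f)\}$, where $(e,f)$ has source $e$ and range $f$. \textbf{Matrices} (for fixed orderings of $V$ and $E$; the spectra do not depend on the orderings). For $v,w\in V$ let $n_{vw}=|s^{-1}(v)\cap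 r^{-1}(w)|$ be the number of edges from $v$ to $w$. \begin{itemize} \item Incidence matrix $\mathbf{M}=(m_{ve})_{v\in V,e\in E}$: $m_{ve}=1$ if $s(e)=v\ne r(e)$, $m_{ve}=-1$ if $r(e)=v\neq s(e)$, and $0$ otherwise. Laplacian $\boldsymbol{\Delta}=\mathbf{M}\mathbf{M}^T$. \item Adjacency matrix $\mathbf{A}=(n_{vw})_{v,w\in V}$. Binary adjacency matrix $\mathbf{A}_b$: $(v,w)$-entry $1$ if $n_{vw}>0$ and $0$ otherwise. \item Line adjacency matrix $\mathbf{L}=(b_{ef})_{e,f\in E}$: $b_{ef}=1$ if $r(e)=s(f)$ and $0$ otherwise (the adjacency matrix of $\mathcal{L}(D)$). \item Hermitian adjacency matrix $\mathbf{H}=(h_{vw})_{v,w\in V}$: $h_{vw}=1$ if $n_{vw}>0$ and $n_{wv}>0$; $h_{vw}=i$ if $n_{vw}>0$ and $n_{wv}=0$; $h_{vw}=-i$ if $n_{vw}=0$ and $n_{wv}>0$; $h_{vw}=0$ otherwise. \item Skew adjacency matrix $\mathbf{S}=\mathbf{A}-\mathbf{A}^T$; binary skew adjacency matrix $\mathbf{S}_b=\mathbf{A}_b-\mathbf{A}_b^T$. \item Skew Laplacian $\boldsymbol{\Delta}_S=\operatorname{diag}(d^{out}_v-d^{in}_v)-\mathbf{S}$; binary skew Laplacian $\boldsymbol{\Delta}_{b,S}=\operatorname{diag}(d^{b,out}_v-d^{b,in}_v)-\mathbf{S}_b$. \item For $D$ strongly connected: the transition probability matrix $\mathbf{P}$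 has entries $p_{vw}=n_{vw}/d^{out}_v$ if $n_{vw}>0$ and $0$ otherwise. Let $\phi$ be the unique left eigenvector of $\mathbf{P}$ with positive entries summing to $1$ (Perron--Frobenius vector), and let $\boldsymbol{\Phi}$ be the diagonal matrix with the entries of $\phi$ on the diagonal. Normalized Laplacian: $\boldsymbol{\Delta}_N=I-\frac12\big(\boldsymbol{\Phi}^{1/2}\mathbf{P}\boldsymbol{\Phi}^{-1/2}+\boldsymbol{\Phi}^{-1/2}\mathbf{P}^T\boldsymbol{\Phi}^{1/2}\big)$. Combinatorial Laplacian: $\boldsymbol{\Delta}_C=\boldsymbol{\Phi}-\frac12\big(\boldsymbol{\Phi}\mathbf{P}+\mathbf{P}^T\boldsymbol{\Phi}\big)$. The binary versions $\boldsymbol{\Delta}_{b,N}$ and $\boldsymbol{\Delta}_{b,C}$ are defined identically with $\mathbf{P}$ replaced throughout (including in the definition of $\phi$) by $\mathbf{P}_b$, whose $(v,w)$-entry is $1/d^{b,out}_v$ if $n_{vw}>0$ and $0$ otherwise. \end{itemize} \textbf{Spectra.} For $X\in\{\boldsymbol{\Delta},\mathbf{A},\mathbf{A}_b,\mathbf{L},\mathbf{H},\mathbf{S},\mathbf{S}_b,\boldsymbol{\Delta}_S,\boldsymbol{\Delta}_{b,S},\boldsymbol{\Delta}_N,\boldsymbol{\Delta}_{b,N},\boldsymbol{\Delta}_C,\boldsymbol{\Delta}_{b,C}\}$, $\operatorname{Spec}_X(D)$ is the multiset of complex eigenvalues of $X(D)$, counted with algebraic multiplicity. $\operatorname{Spec}^{\mathcal{S}}_{\mathbf{A}}(D)$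 and $\operatorname{Spec}^{\mathcal{S}}_{\mathbf{A}_b}(D)$ are the multisets of eigenvalues of $\mathbf{A}\mathbf{A}^T$ and $\mathbf{A}_b\mathbf{A}_b^T$, respectively. \textbf{Moves}, applied to $D=(V,E,r,s)$: \begin{itemize} \item \emph{Move (S)} (remove a regular source): given a regular vertex $v_s$ that is a source, delete $v_s$ and all edges in $s^{-1}(v_s)$. \item \emph{Move (R)} (reduce at a regular vertex): given a regular vertex $v_r$ such that $s^{-1}(v_r)=\{f\}$ and $s(r^{-1}(v_r))=\{u\}$ are one-point sets, with $u\ne v_r$, delete $v_r$, delete $f$ and all edges of $r^{-1}(v_r)$, and add for each $e\in r^{-1}(v_r)$ an edge $ef$ with source $u$ and range $r(f)$. \item \emph{Move (O)} (outsplit at a non-sink): given a vertex $v$ that is not a sink and a partition $\{\mathcal{E}_1,\dots,\mathcal{E}_n\}$ of $s^{-1}(v)$ (into finitely many nonempty sets), replace $v$ by vertices $v^1,\dots,v^n$ and replace each edge $e\in r^{-1}(v)$ by edges $e^1,\dots,e^n$. Ranges: $r(e^j)=v^j$ for $e\in r^{-1}(v)$, and ranges of other edges are unchanged. Sources: an edge $e\in s^{-1}(v)\setminus r^{-1}(v)$ with $e\in\mathcal{E}_i$ has new source $v^i$; for $e\in s^{-1}(v)\cap r^{-1}(v)$ with $e\in\mathcal{E}_i$, all $e^j$ have source $v^i$; for $e\in r^{-1}(v)\setminus s^{-1}(v)$, all $e^j$ have source $s(e)$; sources of all other edges are unchanged. \item \emph{Move (I)} (insplit at a regular non-source): given a regular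 vertex $v$ that is not a source and a partition $\{\mathcal{E}_1,\dots,\mathcal{E}_n\}$ of $r^{-1}(v)$ (into finitely many nonempty sets), replace $v$ by $v^1,\dots,v^n$ and each edge $e\in s^{-1}(v)$ by edges $e^1,\dots,e^n$. Sources: $s(e^j)=v^j$ for $e\in s^{-1}(v)$, and sources of other edges are unchanged. Ranges: an edge $e\in r^{-1}(v)\setminus s^{-1}(v)$ with $e\in\mathcal{E}_i$ has new range $v^i$; for $e\in r^{-1}(v)\cap s^{-1}(v)$ with $e\in\mathcal{E}_i$, all $e^j$ have range $v^i$; for $e\in s^{-1}(v)\setminus r^{-1}(v)$, all $e^j$ have range $r(e)$; ranges of all other edges are unchanged. \item \emph{Move (C)} (Cuntz splice): given a regular vertex $v$ that supports at least two distinct return paths, add two new vertices $u_1,u_2$ and six new edges: $e_1$ from $v$ to $u_1$, $e_2$ from $u_1$ to $v$, $f_1$ from $u_1$ to $u_1$, $f_2$ from $u_1$ to $u_2$, $h_1$ from $u_2$ to $u_1$, $h_2$ from $u_2$ to $u_2$. \item \emph{Move (P)} (eclose a cyclic component): let $v$ be a vertex that supports a loop but no other return path, such that the loop has an exit. Let $S=\{w\in V\setminus\{v\}: n_{vw}>0\}$, and suppose every $w\in S$ is a regular vertex supporting at least two return paths. Perform the Cuntz splice of Move (C) at every $w\in S$, denoting the new vertices by $u_1^w,u_2^w$; then for each $w\in S$ and each edge $e\in s^{-1}(v)\cap r^{-1}(w)$ add two further edges $\bar e_w,\tilde e_w$ from $v$ to $u_2^w$. \end{itemize} \textbf{Preservation.}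 A move \emph{preserves} the multiset of nonzero elements of a spectrum (within a class of finite digraphs) if for every $D$ in the class and every digraph $D'$ in the class obtained from $D$ by one application of the move (at any admissible choice of data), the multisets of nonzero elements of the spectrum of $D$ and of $D'$ are equal. It \emph{does not preserve} it if there exist such $D$ and $D'$ in the class for which these multisets differ. *)

(* Defs.v *)
From HB Require Import structures.
From mathcomp Require Import all_boot all_order all_algebra.
From mathcomp Require classical_sets.
From Stdlib Require List.

Set Implicit Arguments.
Unset Strict Implicit.
Unset Printing Implicit Defensive.

Import Order.TTheory GRing.Theory Num.Theory.

Record digraph := Digraph {
  vertex : finType;
  edge : finType;
  src : edge -> vertex;
  tgt : edge -> vertex }.

Arguments Digraph {vertex edge} src tgt.
Arguments src {d} e.
Arguments tgt {d} e.

Definition digraph_iso (D D' : digraph) : Prop :=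
  exists (f : vertex D -> vertex D') (g : edge D -> edge D'),
    [/\ bijective f, bijective g,
        forall e, src (g e) = f (src e) & forall e, tgt (g e) = f (tgt e)].

Section Digraph.
Variable D : digraph.
Implicit Types (u v w : vertex D) (e f : edge D) (p q : seq (edge D)).

Definition out_edges v : {set edge D} := [set e | src e == v].
Definition in_edges v : {set edge D} := [set e | tgt e == v].

Definition is_source v : bool := in_edges v == set0.
Definition is_sink v : bool := out_edges v == set0.
(* [out_edges v] is automatically finite here. *)
Definition regular v : bool := out_edges v != set0.

Definition composable : rel (edge D) := fun e f => tgt e == src f.

(* [path.cycle r [::]] holds, hence the separate nonemptiness condition. *)
Definition is_cycle p : bool := (p != [::]) && path.cycle composable p.

Definition has_exit p : Prop :=
  exists e f, [/\ e \in p, f != e & src f = src e].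

(* [p] is a return path supported by [v]: a cycle whose last edge ends in [v]
   and whose other edges do not. *)
Definition return_path v p : bool :=
  if p is e :: q then
    [&& is_cycle p, tgt (last e q) == v
      & all (fun f => tgt f != v) (belast e q)]
  else false.

Definition supports_two_return_paths v : Prop :=
  exists p q, [/\ p != q, return_path v p & return_path v q].

(* A path of length 0 leads from each vertex to itself. *)
Definition path_between v p w : bool :=
  if p is e :: q then
    [&& src e == v, path composable e q & tgt (last e q) == w]
  else v == w.

Definition strongly_connected : Prop :=
  forall v w, exists p, path_between v p w.

Definition nedges v w : nat := #|out_edges v :&: in_edges w|.

Definition outdeg v : nat := #|out_edges v|.
Definition indeg v : nat := #|in_edges v|.
Definition boutdeg v : nat := #|[set tgt e | e in out_edges v]|.
Definition bindeg v : nat := #|[set src e | e in in_edges v]|.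

End Digraph.

Arguments strongly_connected D : clear implicits.

Section RemoveSource.
Variables (D : digraph) (v : vertex D).

Lemma is_source_tgt (e : edge D) : is_source v -> tgt e != v.
Proof.
move=> /eqP sv; apply/negP => tev.
by have := in_set0 e; rewrite -sv inE tev.
Qed.

Definition remove_source (sv : is_source v) : digraph :=
  @Digraph {w : vertex D | w != v} {e : edge D | src e != v}
    (fun e => exist _ (src (val e)) (valP e))
    (fun e => exist _ (tgt (val e)) (is_source_tgt (val e) sv)).

End RemoveSource.

Definition move_S (D D' : digraph) : Prop :=
  exists (v : vertex D) (sv : is_source v),
    regular v /\ digraph_iso (remove_source sv) D'.

Section Reduce.
Variables (D : digraph) (v u : vertex D) (f : edge D).

Definition reducible : bool :=
  [&& out_edges v == [set f],
      [set src e | e in in_edges v] == [set u] & u != v].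

Lemma reducible_src (e : edge D) :
  reducible -> (e != f) && (tgt e != v) -> src e != v.
Proof.
case/and3P=> /eqP of_v _ _ /andP[nef _]; apply: contra nef => sev.
by rewrite -in_set1 -of_v inE.
Qed.

Lemma reducible_tgt (e : edge D) : (e != f) && (tgt e != v) -> tgt e != v.
Proof. by case/andP. Qed.

Lemma reducible_neq : reducible -> u != v.
Proof. by case/and3P. Qed.

Lemma reducible_tgt_f : reducible -> tgt f != v.
Proof.
case/and3P=> /eqP of_v /eqP su nuv; apply/negP => tfv.
have sfv : src f = v.
  by apply/eqP; have := set11 f; rewrite -of_v inE.
have : src f \in [set u] by rewrite -su imset_f // inE.
by rewrite sfv inE eq_sym (negPf nuv).
Qed.

(* [inr e], for [e] with range [v], is the new edge written [ef]. *)
Definition reduce (h : reducible) : digraph :=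
  @Digraph {w : vertex D | w != v}
    ({e : edge D | (e != f) && (tgt e != v)} + {e : edge D | tgt e == v})%type
    (fun x => match x with
      | inl e => exist _ (src (val e)) (reducible_src h (valP e))
      | inr _ => exist _ u (reducible_neq h)
      end)
    (fun x => match x with
      | inl e => exist _ (tgt (val e)) (reducible_tgt (valP e))
      | inr _ => exist _ (tgt f) (reducible_tgt_f h)
      end).

End Reduce.

Definition move_R (D D' : digraph) : Prop :=
  exists (v u : vertex D) (f : edge D) (h : reducible v u f),
    regular v /\ digraph_iso (reduce h) D'.

Section Split.
Variables (D : digraph) (v : vertex D) (P : {set {set edge D}}).

(* The other vertices, and one copy of [v] for each block of the partition. *)
Definition split_vertex : Type :=
  ({w : vertex D | w != v} + {B : {set edge D} | B \in P})%type.

Lemma block_subproof (A : {set edge D}) (e : edge D) :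
  partition P A -> e \in A -> pblock P e \in P.
Proof. by move=> /and3P[/eqP covP _ _] eA; apply: pblock_mem; rewrite covP. Qed.

Section Outsplit.
Hypothesis hP : partition P (out_edges v).

Lemma outsplit_block (e : edge D) : src e == v -> pblock P e \in P.
Proof. by move=> sev; apply: (block_subproof hP); rewrite inE. Qed.

Definition outsplit_src (e : edge D) : split_vertex :=
  match boolP (src e == v) with
  | AltTrue h => inr (exist _ (pblock P e) (outsplit_block h))
  | AltFalse h => inl (exist _ (src e) h)
  end.

(* [inr (e, B)] is the copy of [e] with range the copy [B] of [v]. *)
Definition outsplit : digraph :=
  @Digraph ({w : vertex D | w != v} + {B : {set edge D} | B \in P})%type
    ({e : edge D | tgt e != v}
     + {e : edge D | tgt e == v} * {B : {set edge D} | B \in P})%type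
    (fun x => match x with
      | inl e => outsplit_src (val e)
      | inr (e, _) => outsplit_src (val e)
      end)
    (fun x => match x with
      | inl e => inl (exist _ (tgt (val e)) (valP e))
      | inr (_, B) => inr B
      end).

End Outsplit.

Section Insplit.
Hypothesis hP : partition P (in_edges v).

Lemma insplit_block (e : edge D) : tgt e == v -> pblock P e \in P.
Proof. by move=> tev; apply: (block_subproof hP); rewrite inE. Qed.

Definition insplit_tgt (e : edge D) : split_vertex :=
  match boolP (tgt e == v) with
  | AltTrue h => inr (exist _ (pblock P e) (insplit_block h))
  | AltFalse h => inl (exist _ (tgt e) h)
  end.

Definition insplit : digraph :=
  @Digraph ({w : vertex D | w != v} + {B : {set edge D} | B \in P})%type
    ({e : edge D | src e != v}
     + {e : edge D | src e == v} * {B : {set edge D} | B \in P})%type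
    (fun x => match x with
      | inl e => inl (exist _ (src (val e)) (valP e))
      | inr (_, B) => inr B
      end)
    (fun x => match x with
      | inl e => insplit_tgt (val e)
      | inr (e, _) => insplit_tgt (val e)
      end).

End Insplit.

End Split.

Definition move_O (D D' : digraph) : Prop :=
  exists (v : vertex D) (P : {set {set edge D}})
         (hP : partition P (out_edges v)),
    ~~ is_sink v /\ digraph_iso (outsplit hP) D'.

Definition move_I (D D' : digraph) : Prop :=
  exists (v : vertex D) (P : {set {set edge D}})
         (hP : partition P (in_edges v)),
    [/\ regular v, ~~ is_source v & digraph_iso (insplit hP) D'].

Inductive splice_vertex := su1 | su2.
Inductive splice_edge := se1 | se2 | sf1 | sf2 | sh1 | sh2.

Definition splice_vertex_code (x : splice_vertex) : bool :=
  if x is su1 then true else false.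
Definition splice_vertex_decode (b : bool) : splice_vertex :=
  if b then su1 else su2.
Lemma splice_vertex_codeK : cancel splice_vertex_code splice_vertex_decode.
Proof. by case. Qed.
HB.instance Definition _ :=
  Finite.copy splice_vertex (can_type splice_vertex_codeK).

Definition splice_edge_code (x : splice_edge) : 'I_6 :=
  match x with
  | se1 => inord 0 | se2 => inord 1 | sf1 => inord 2
  | sf2 => inord 3 | sh1 => inord 4 | sh2 => inord 5
  end.
Definition splice_edge_decode (i : 'I_6) : splice_edge :=
  nth se1 [:: se1; se2; sf1; sf2; sh1; sh2] i.
Lemma splice_edge_codeK : cancel splice_edge_code splice_edge_decode.
Proof. by case; rewrite /splice_edge_decode /= inordK. Qed.
HB.instance Definition _ :=
  Finite.copy splice_edge (can_type splice_edge_codeK).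

Section Splice.
Variables (D : digraph) (S : {set vertex D}).

(* Vertices of [D] with a Cuntz splice performed at every element of [S];
   [inr (w, su1)] and [inr (w, su2)] are the new vertices attached to [w]. *)
Definition spliced_vertex : Type :=
  (vertex D + {w : vertex D | w \in S} * splice_vertex)%type.

Definition splice_src (w : {w : vertex D | w \in S}) (k : splice_edge) :
    spliced_vertex :=
  match k with
  | se1 => inl (val w)
  | se2 | sf1 | sf2 => inr (w, su1)
  | sh1 | sh2 => inr (w, su2)
  end.

Definition splice_tgt (w : {w : vertex D | w \in S}) (k : splice_edge) :
    spliced_vertex :=
  match k with
  | se2 => inl (val w)
  | se1 | sf1 | sh1 => inr (w, su1)
  | sf2 | sh2 => inr (w, su2)
  end.

Definition cuntz_splice : digraph :=
  @Digraph (vertex D + {w : vertex D | w \in S} * splice_vertex)%type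
    (edge D + {w : vertex D | w \in S} * splice_edge)%type
    (fun x => match x with
      | inl e => inl (src e)
      | inr (w, k) => splice_src w k
      end)
    (fun x => match x with
      | inl e => inl (tgt e)
      | inr (w, k) => splice_tgt w k
      end).

Lemma eclose_tgt (v : vertex D) (e : edge D) :
  (src e == v) && (tgt e \in S) -> tgt e \in S.
Proof. by case/andP. Qed.

(* The splices at all elements of [S], together with two new edges
   [inr (e, true)] and [inr (e, false)] from [v] to the second new vertex
   attached to [tgt e], for each edge [e] from [v] to an element of [S]. *)
Definition eclose (v : vertex D) : digraph :=
  @Digraph (vertex cuntz_splice)
    (edge cuntz_splice
     + {e : edge D | (src e == v) && (tgt e \in S)} * bool)%type
    (fun x => match x with
      | inl e => src e
      | inr (_, _) => inl v
      end)
    (fun x => match x with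
      | inl e => tgt e
      | inr (e, _) => inr (exist _ (tgt (val e)) (eclose_tgt (valP e)), su2)
      end).

End Splice.

Definition move_C (D D' : digraph) : Prop :=
  exists v : vertex D,
    [/\ regular v, supports_two_return_paths v
      & digraph_iso (cuntz_splice [set v]) D'].

Definition move_P (D D' : digraph) : Prop :=
  exists (v : vertex D) (l : edge D),
    let S := [set w | (w != v) && (0 < nedges v w)] in
    [/\ src l = v /\ tgt l = v,
        forall p, return_path v p -> p = [:: l],
        has_exit [:: l],
        forall w, w \in S -> regular w /\ supports_two_return_paths w
      & digraph_iso (eclose S v) D'].

Local Open Scope ring_scope.

(* The matrix with entries [F t u], for the enumeration orders of [T], [U]. *)
Definition mx_of (C : Type) (T U : finType) (F : T -> U -> C) :
    'M[C]_(#|T|, #|U|) :=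
  \matrix_(i, j) F (enum_val i) (enum_val j).

(* The roots of the characteristic polynomial, with multiplicity; as a
   multiset, this sequence is to be considered up to [perm_eq]. *)
Definition eigenvalues (C : closedFieldType) n (M : 'M[C]_n) : seq C :=
  sval (closed_field_poly_normal (char_poly M)).

Definition spectrum (C : Type) := digraph -> seq C.

Section Matrices.
Variables (C : numClosedFieldType) (D : digraph).
Implicit Types (v w : vertex D) (e f : edge D).

Local Notation VMatrix := 'M[C]_#|vertex D|.

Definition incidence : 'M[C]_(#|vertex D|, #|edge D|) :=
  mx_of (fun v e =>
    if (src e == v) && (tgt e != v) then 1
    else if (tgt e == v) && (src e != v) then -1 else 0).

Definition laplacian : VMatrix := incidence *m incidence^T.

Definition adjacency : VMatrix := mx_of (fun v w => (nedges v w)%:R).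

Definition badjacency : VMatrix :=
  mx_of (fun v w => if (0 < nedges v w)%N then 1 else 0).

Definition line_adjacency : 'M[C]_#|edge D| :=
  mx_of (fun e f => if tgt e == src f then 1 else 0).

Definition hermitian_adjacency : VMatrix :=
  mx_of (fun v w =>
    match (0 < nedges v w)%N, (0 < nedges w v)%N with
    | true, true => 1
    | true, false => 'i
    | false, true => - 'i
    | false, false => 0
    end).

Definition skew_adjacency : VMatrix := adjacency - adjacency^T.

Definition bskew_adjacency : VMatrix := badjacency - badjacency^T.

Definition vdiag (d : vertex D -> C) : VMatrix :=
  diag_mx (\row_i d (enum_val i)).

Definition skew_laplacian : VMatrix :=
  vdiag (fun v => (outdeg v)%:R - (indeg v)%:R) - skew_adjacency.

Definition bskew_laplacian : VMatrix :=
  vdiag (fun v => (boutdeg v)%:R - (bindeg v)%:R) - bskew_adjacency.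

Definition transition : VMatrix :=
  mx_of (fun v w =>
    if (0 < nedges v w)%N then (nedges v w)%:R / (outdeg v)%:R else 0).

Definition btransition : VMatrix :=
  mx_of (fun v w => if (0 < nedges v w)%N then (boutdeg v)%:R^-1 else 0).

End Matrices.

Section PerronFrobenius.
Variables (C : numClosedFieldType) (n : nat) (P : 'M[C]_n).

Definition is_perron_vector (phi : 'rV[C]_n) : Prop :=
  [/\ exists a : C, phi *m P = a *: phi,
      forall i, 0 < phi 0 i
    & \sum_i phi 0 i = 1].

(* The default value 0 is irrelevant when [P] is one of the transition matrices
   of a nonempty strongly connected digraph: then exactly one vector satisfies
   [is_perron_vector]. *)
Definition perron_vector : 'rV[C]_n := classical_sets.xget 0 is_perron_vector.

Definition Phi : 'M[C]_n := diag_mx perron_vector.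
Definition Phi_sqrt : 'M[C]_n := diag_mx (map_mx sqrtC perron_vector).
Definition Phi_sqrtV : 'M[C]_n :=
  diag_mx (map_mx (fun x => (sqrtC x)^-1) perron_vector).

Definition normalized_laplacian : 'M[C]_n :=
  1%:M - 2^-1 *: (Phi_sqrt *m P *m Phi_sqrtV + Phi_sqrtV *m P^T *m Phi_sqrt).

Definition combinatorial_laplacian : 'M[C]_n :=
  Phi - 2^-1 *: (Phi *m P + P^T *m Phi).

End PerronFrobenius.

Section Spectra.
Variable C : numClosedFieldType.

Definition Spec_Delta : spectrum C := fun D => eigenvalues (laplacian C D).
Definition Spec_A : spectrum C := fun D => eigenvalues (adjacency C D).
Definition Spec_Ab : spectrum C := fun D => eigenvalues (badjacency C D).
Definition Spec_L : spectrum C := fun D => eigenvalues (line_adjacency C D).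
Definition Spec_H : spectrum C :=
  fun D => eigenvalues (hermitian_adjacency C D).
Definition Spec_S : spectrum C := fun D => eigenvalues (skew_adjacency C D).
Definition Spec_Sb : spectrum C := fun D => eigenvalues (bskew_adjacency C D).
Definition Spec_DeltaS : spectrum C :=
  fun D => eigenvalues (skew_laplacian C D).
Definition Spec_DeltabS : spectrum C :=
  fun D => eigenvalues (bskew_laplacian C D).
Definition Spec_symA : spectrum C :=
  fun D => eigenvalues (adjacency C D *m (adjacency C D)^T).
Definition Spec_symAb : spectrum C :=
  fun D => eigenvalues (badjacency C D *m (badjacency C D)^T).

(* The following four are meaningful for strongly connected digraphs only. *)
Definition Spec_DeltaN : spectrum C :=
  fun D => eigenvalues (normalized_laplacian (transition C D)).
Definition Spec_DeltabN : spectrum C :=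
  fun D => eigenvalues (normalized_laplacian (btransition C D)).
Definition Spec_DeltaC : spectrum C :=
  fun D => eigenvalues (combinatorial_laplacian (transition C D)).
Definition Spec_DeltabC : spectrum C :=
  fun D => eigenvalues (combinatorial_laplacian (btransition C D)).

End Spectra.

Definition move := digraph -> digraph -> Prop.

Definition all_digraphs (D : digraph) : Prop := True.

Section Preservation.
Variables (C : numClosedFieldType) (cls : digraph -> Prop).

Definition nonzero_part (s : seq C) : seq C := [seq z <- s | z != 0].

Definition preserves (m : move) (X : spectrum C) : Prop :=
  forall D D', cls D -> cls D' -> m D D' ->
    perm_eq (nonzero_part (X D)) (nonzero_part (X D')).

Definition does_not_preserve (m : move) (X : spectrum C) : Prop :=
  exists D D', [/\ cls D, cls D', m D D'
    & ~~ perm_eq (nonzero_part (X D)) (nonzero_part (X D'))].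

Definition each_preserves (ms : seq move) (Xs : seq (spectrum C)) : Prop :=
  forall m X, List.In m ms -> List.In X Xs -> preserves m X.

Definition none_preserves (ms : seq move) (Xs : seq (spectrum C)) : Prop :=
  forall m X, List.In m ms -> List.In X Xs -> does_not_preserve m X.

End Preservation.

(* Main.v *)
(* If F = XY and G = YX for rectangular matrices X and Y, then F and G have the
   same nonzero eigenvalues with multiplicities. The positive results are
   instances. Outsplitting factors A through the matrix recording how the copies
   of the split vertex cover it; insplitting is outsplitting of the opposite
   digraph. A and L are XY and YX for the range and source matrices. Removing a
   source deletes a zero column, and a Cuntz splice adds a symmetric pattern of
   edges, hence extends the skew matrices by zero.

   The negative results compare the traces of M or of M^2, that is, the sums of
   the eigenvalues or of their squares, on digraphs with at most four vertices.
   For the normalized and combinatorial Laplacians of a digraph with symmetric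
   adjacency matrix the degrees give a stationary distribution phi, and the
   traces, namely the sums of 1 - p_vv and of phi_v (1 - p_vv), vanish if there
   is one vertex only and are positive if there is an edge that is not a loop.
     *)
Require Import Defs.
From mathcomp Require Import all_boot all_order all_algebra.
From mathcomp Require Import reals complex.
From mathcomp Require Import spectral ring.

Set Implicit Arguments.
Unset Strict Implicit.
Unset Printing Implicit Defensive.

Import Order.TTheory GRing.Theory Num.Theory.

Local Open Scope ring_scope.

(** * Nonzero eigenvalues *)

Section Eigenvalues.
Variable C : numClosedFieldType.

Lemma prod_eigenvalues n (M : 'M[C]_n) :
  \prod_(z <- eigenvalues M) ('X - z%:P) = char_poly M.
Proof.
rewrite /eigenvalues; case: closed_field_poly_normal => s /= def_s.
by rewrite [RHS]def_s (monicP (char_poly_monic M)) scale1r.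
Qed.

(** One block matrix, with blocks ['X], [X], [Y] and 1, is evaluated after two block row operations.
    Scaling a block row by ['X] instead of dividing by it keeps everything polynomial; the powers of
    ['X] left over account for the extra zero eigenvalues. *)
Lemma mulmxC_char_poly m n (X : 'M[C]_(m, n)) (Y : 'M[C]_(n, m)) :
  'X^n * char_poly (X *m Y) = 'X^m * char_poly (Y *m X).
Proof.
pose X' := map_mx polyC X; pose Y' := map_mx polyC Y.
pose B := block_mx 'X%:M X' Y' 1%:M.
have E1 : \det B = char_poly (X *m Y).
  transitivity (\det (block_mx 1%:M (- X') 0 1%:M *m B)).
    by rewrite det_mulmx det_ublock !det1 !mul1r.
  rewrite mulmx_block !mul0mx !mul1mx !mulmx1 !add0r subrr det_lblock det1
    mulr1.
  by rewrite /char_poly /char_poly_mx map_mxM mulNmx.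
have E2 : 'X^n * \det B = 'X^m * char_poly (Y *m X).
  transitivity (\det (block_mx 1%:M 0 (- Y') 'X%:M *m B)).
    by rewrite det_mulmx det_lblock !det1 !det_scalar mul1r.
  rewrite mulmx_block !mul0mx !mul1mx !addr0 mulmx1 mul_mx_scalar mul_scalar_mx.
  rewrite scalerN addNr det_ublock det_scalar; congr (_ * _).
  by rewrite /char_poly /char_poly_mx map_mxM mulNmx addrC.
by rewrite -E1 E2.
Qed.

(** By unique factorization into linear factors, the two lists of roots agree once padded with [a]
    and [b] zeros, and [nonzero_part] discards the padding. *)
Lemma perm_nonzero_eigenvalues m n (M : 'M[C]_m) (N : 'M[C]_n) a b :
  'X^a * char_poly M = 'X^b * char_poly N ->
  perm_eq (nonzero_part (eigenvalues M)) (nonzero_part (eigenvalues N)).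
Proof.
rewrite -!prod_eigenvalues => eqMN.
suff /(perm_filter (predC1 0)) :
    perm_eq (nseq a 0 ++ eigenvalues M) (nseq b 0 ++ eigenvalues N).
  by rewrite !filter_cat !filter_nseq /= eqxx.
have prod0 k : \prod_(x <- nseq k (0 : C)) ('X - x%:P) = 'X^k.
  by rewrite big_nseq subr0 iter_mulr_1.
by apply: prod_XsubC_eq; rewrite !big_cat /= !prod0.
Qed.

(** Schur triangularization, from which the power sums of the eigenvalues are read off: similarity
    keeps the characteristic polynomial and the traces, and a triangular matrix carries its
    eigenvalues on the diagonal. *)
Lemma triangular_form n (M : 'M[C]_n) :
  exists T : 'M[C]_n, [/\ perm_eq (eigenvalues M) [seq T i i | i : 'I_n],
    \tr M = \tr T, \tr (M *m M) = \tr (T *m T) & is_trig_mx T].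
Proof.
(* [Schur] asks for positive size, so the empty matrix is treated apart. *)
have [n0|n_gt0] := posnP n.
  subst n; exists 0; rewrite [M]flatmx0; split=> //; last exact: mx0_is_trig.
  apply: prod_XsubC_eq; rewrite prod_eigenvalues big_map big_enum /= big_ord0.
  by rewrite /char_poly det_mx00.
have [P /unitarymx_unit Pu T_trig] := Schur M n_gt0.
set T := conjmx P M in T_trig.
have TE : T = P *m M *m invmx P by rewrite /T conjumx.
have trE (A : 'M[C]_n) : \tr (P *m A *m invmx P) = \tr A.
  by rewrite mxtrace_mulC mulmxA mulVmx // mul1mx.
exists T; split=> //; first last.
- by rewrite -trE TE !mulmxA mulmxKV // -!mulmxA.
- by rewrite -trE TE.
apply: prod_XsubC_eq; rewrite prod_eigenvalues big_map big_enum /=.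
rewrite -char_poly_trig // TE /char_poly.
have -> : char_poly_mx (P *m M *m invmx P) =
    map_mx polyC P *m char_poly_mx M *m map_mx polyC (invmx P).
  rewrite /char_poly_mx mulmxBr mulmxBl !map_mxM /=; congr (_ - _).
  by rewrite scalar_mxC -mulmxA -map_mxM mulmxV // map_mx1 mulmx1.
rewrite !det_mulmx mulrAC -det_mulmx -map_mxM mulmxV // map_mx1 det1.
by rewrite mul1r.
Qed.

Lemma sum_eigenvalues n (M : 'M[C]_n) : \sum_(z <- eigenvalues M) z = \tr M.
Proof.
have [T [eT -> _ _]] := triangular_form M.
by rewrite (perm_big _ eT) big_map big_enum.
Qed.

Lemma sum_eigenvalues2 n (M : 'M[C]_n) :
  \sum_(z <- eigenvalues M) z ^+ 2 = \tr (M *m M).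
Proof.
have [T [eT _ -> T_trig]] := triangular_form M.
rewrite (perm_big _ eT) big_map big_enum /=; apply: eq_bigr => i _.
(* Off the diagonal, one of the factors [T i j] and [T j i] lies above the diagonal of the
   triangular matrix and vanishes. *)
rewrite mxE (bigD1 i) //= big1 ?addr0 // => j ne_ji.
have [lt_ij|lt_ji|/val_inj eq_ij] := ltngtP i j.
- by rewrite (is_trig_mxP T_trig i j) ?mul0r.
- by rewrite (is_trig_mxP T_trig j i) ?mulr0.
- by rewrite eq_ij eqxx in ne_ji.
Qed.

(** Zeros contribute nothing to a positive power sum; the exponent [k.+1] excludes the power 0,
    which would count them. *)
Lemma sum_nonzero_part (s : seq C) k :
  \sum_(z <- nonzero_part s) z ^+ k.+1 = \sum_(z <- s) z ^+ k.+1.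
Proof.
rewrite big_filter big_mkcond; apply: eq_bigr => z _ /=.
by case: eqVneq => //= ->; rewrite expr0n.
Qed.

Lemma trace_mx_of (T : finType) (F : T -> T -> C) :
  \tr (mx_of F) = \sum_t F t t.
Proof.
rewrite [RHS]big_enum_val; apply: eq_bigr => i _; by rewrite mxE.
Qed.

Lemma mx_of_mul (T U V : finType) (F : T -> U -> C) (G : U -> V -> C) :
  mx_of F *m mx_of G = mx_of (fun t v => \sum_u F t u * G u v).
Proof.
apply/matrixP => i j; rewrite !mxE [RHS]big_enum_val.
by apply: eq_bigr => k _; rewrite !mxE.
Qed.

Lemma trmx_mx_of (T U : finType) (F : T -> U -> C) :
  (mx_of F)^T = mx_of (fun u t => F t u).
Proof. by apply/matrixP => i j; rewrite !mxE. Qed.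

Lemma mx_ofB (T U : finType) (F G : T -> U -> C) :
  mx_of F - mx_of G = mx_of (fun t u => F t u - G t u).
Proof. by apply/matrixP => i j; rewrite !mxE. Qed.

Lemma eq_mx_of (T U : finType) (F G : T -> U -> C) :
  (forall t u, F t u = G t u) -> mx_of F = mx_of G.
Proof. by move=> eqFG; apply/matrixP => i j; rewrite !mxE. Qed.

Lemma eq_nonzero_eigenvalues_mul (T U : finType) (F : T -> T -> C)
    (G : U -> U -> C) (X : T -> U -> C) (Y : U -> T -> C) :
    (forall t t', F t t' = \sum_u X t u * Y u t') ->
    (forall u u', G u u' = \sum_t Y u t * X t u') ->
  perm_eq (nonzero_part (eigenvalues (mx_of F)))
          (nonzero_part (eigenvalues (mx_of G))).
Proof.
move=> /eq_mx_of -> /eq_mx_of ->; rewrite -!mx_of_mul.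
apply: perm_nonzero_eigenvalues; exact: mulmxC_char_poly.
Qed.

(** The columns of [F] outside the image of [h] vanish, so [F] is its block of columns along [h]
    times the 0-1 matrix of [h]. The product in the other order is the restriction of [F] to the
    image, that is, [G]. *)
Lemma eq_nonzero_eigenvalues_inj (T U : finType) (F : T -> T -> C)
    (G : U -> U -> C) (h : U -> T) :
    injective h -> (forall t t', t' \notin codom h -> F t t' = 0) ->
    (forall u u', G u u' = F (h u) (h u')) ->
  perm_eq (nonzero_part (eigenvalues (mx_of F)))
          (nonzero_part (eigenvalues (mx_of G))).
Proof.
move=> h_inj F0 GE.
apply: (@eq_nonzero_eigenvalues_mul _ _ _ _
  (fun t u => F t (h u)) (fun u t => (h u == t)%:R)) => [t t'|u u'].
  have [/codomP[u ->]|t'_h] := boolP (t' \in codom h).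
    rewrite (bigD1 u) //= eqxx mulr1 big1 ?addr0 // => u' /negPf ne_u'u.
    by rewrite (inj_eq h_inj) ne_u'u mulr0.
  rewrite F0 // big1 // => u _; case: eqVneq t'_h => [<-|_ _];
    last exact: mulr0.
  by rewrite codom_f.
rewrite (bigD1 (h u)) //= eqxx mul1r big1 ?addr0 // => t.
by rewrite eq_sym => /negPf ->; rewrite mul0r.
Qed.

End Eigenvalues.

(** * Matrices in terms of edge multiplicities *)

Section Weights.
Variable D : digraph.
Implicit Types v w : vertex D.

Definition bedges v w : nat := (0 < nedges v w)%N.

Lemma nedgesE v w : nedges v w = (\sum_(e : edge D) ((src e == v) && (tgt e ==
  w)))%N.
Proof.
rewrite /nedges -sum1_card big_mkcond; apply: eq_bigr => e _.
by rewrite !inE; case: ifP.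
Qed.

Lemma outdegE v : outdeg v = (\sum_w nedges v w)%N.
Proof.
under eq_bigr do rewrite nedgesE.
rewrite exchange_big /outdeg -sum1_card big_mkcond; apply: eq_bigr => e _ /=.
rewrite inE (bigD1 (tgt e)) //= eqxx andbT big1 ?addn0; first by case: eqP.
by move=> w; rewrite eq_sym => /negPf ->; rewrite andbF.
Qed.

Lemma indegE v : indeg v = (\sum_w nedges w v)%N.
Proof.
under eq_bigr do rewrite nedgesE.
rewrite exchange_big /indeg -sum1_card big_mkcond; apply: eq_bigr => e _ /=.
rewrite inE (bigD1 (src e)) //= eqxx big1 ?addn0; first by case: eqP.
by move=> w; rewrite eq_sym => /negPf ->.
Qed.

Lemma nedges_gt0 v w :
  reflect (exists2 e : edge D, src e = v & tgt e = w) (0 < nedges v w)%N.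
Proof.
rewrite /nedges card_gt0; apply: (iffP (set0Pn _)) => [[e]|[e sev tew]].
  by rewrite !inE => /andP[/eqP ? /eqP ?]; exists e.
by exists e; rewrite !inE sev tew !eqxx.
Qed.

Lemma boutdegE v : boutdeg v = (\sum_w bedges v w)%N.
Proof.
rewrite /boutdeg -sum1_card big_mkcond; apply: eq_bigr => w _.
rewrite /bedges; case: imsetP => [[e]|nvw].
  by rewrite inE => /eqP sev tew; rewrite (introT (nedges_gt0 _ _)) //;
    exists e.
case: nedges_gt0 => // -[e sev tew]; case: nvw.
by exists e; rewrite // inE sev.
Qed.

Lemma bindegE v : bindeg v = (\sum_w bedges w v)%N.
Proof.
rewrite /bindeg -sum1_card big_mkcond; apply: eq_bigr => w _.
rewrite /bedges; case: imsetP => [[e]|nvw].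
  by rewrite inE => /eqP sev tew; rewrite (introT (nedges_gt0 _ _)) //;
    exists e.
case: nedges_gt0 => // -[e sev tew]; case: nvw.
by exists e; rewrite // inE tew.
Qed.

End Weights.

Section SkewWeights.
Variables (T : finType) (N : T -> T -> nat).

(** A row sum of [skew] is an outdegree minus an indegree, which makes [skew_lap] the skew
    Laplacian. Taking [N] to be [nedges] or [bedges] covers the plain and the binary versions, and
    integer values allow evaluation on examples. *)
Definition skew (v w : T) : int := (N v w)%:Z - (N w v)%:Z.
Definition skew_lap (v w : T) : int := (v == w)%:Z * (\sum_x skew v x) - skew v
  w.

Lemma skewvv v : skew v v = 0. Proof. exact: subrr. Qed.

(** Since [skew] vanishes on the diagonal, the diagonal of [skew_lap] consists of the degree
    differences, and off the diagonal the two minus signs cancel. *)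
Lemma trace_skew_lap2 : \sum_v \sum_w skew_lap v w * skew_lap w v =
  \sum_v (\sum_x skew v x) ^+ 2 + \sum_v \sum_w skew v w * skew w v.
Proof.
rewrite -big_split; apply: eq_bigr => v _ /=.
rewrite (bigD1 v) //= [X in _ = _ + X](bigD1 v) //= /skew_lap eqxx !skewvv.
rewrite mul1r subr0 mulr0 add0r; congr (_ + _); apply: eq_bigr => w.
by rewrite eq_sym => /negPf nvw; rewrite nvw !mul0r !sub0r mulrNN.
Qed.

End SkewWeights.

Section MatrixFormulas.
Variables (C : numClosedFieldType) (D : digraph).

Lemma badjacencyE : badjacency C D = mx_of (fun v w => (bedges v w)%:R).
Proof. by apply: eq_mx_of => v w; rewrite /bedges; case: ifP. Qed.

Lemma skew_adjacencyE :
  skew_adjacency C D = mx_of (fun v w => (skew (@nedges D) v w)%:~R).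
Proof.
rewrite /skew_adjacency trmx_mx_of mx_ofB; apply: eq_mx_of => v w.
by rewrite rmorphB.
Qed.

Lemma bskew_adjacencyE :
  bskew_adjacency C D = mx_of (fun v w => (skew (@bedges D) v w)%:~R).
Proof.
rewrite /bskew_adjacency badjacencyE trmx_mx_of mx_ofB; apply: eq_mx_of => v w.
by rewrite rmorphB.
Qed.

Lemma vdiagE (d : vertex D ->
  C) : vdiag d = mx_of (fun v w => (v == w)%:R * d v).
Proof.
by apply/matrixP => i j; rewrite !mxE (inj_eq enum_val_inj) mulr_natl;
  case: eqP => // ->.
Qed.

Lemma skew_laplacianE :
  skew_laplacian C D = mx_of (fun v w => (skew_lap (@nedges D) v w)%:~R).
Proof.
rewrite /skew_laplacian vdiagE skew_adjacencyE mx_ofB.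
apply: eq_mx_of => v w; rewrite [RHS]rmorphB rmorphM; congr (_ * _ - _).
by rewrite outdegE indegE !natr_sum rmorph_sum -sumrB; apply: eq_bigr => x _;
  rewrite rmorphB.
Qed.

Lemma bskew_laplacianE :
  bskew_laplacian C D = mx_of (fun v w => (skew_lap (@bedges D) v w)%:~R).
Proof.
rewrite /bskew_laplacian vdiagE bskew_adjacencyE mx_ofB.
apply: eq_mx_of => v w; rewrite [RHS]rmorphB rmorphM; congr (_ * _ - _).
by rewrite boutdegE bindegE !natr_sum rmorph_sum -sumrB; apply: eq_bigr => x _;
  rewrite rmorphB.
Qed.
End MatrixFormulas.

(** * Moves preserving a spectrum *)

Lemma digraph_iso_sym D D' : digraph_iso D D' -> digraph_iso D' D.
Proof.
case=> f [g [[f' fK f'K] [g' gK g'K] srcE tgtE]]; exists f', g'; split.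
- by exists f.
- by exists g.
- by move=> e; apply: (can_inj fK); rewrite f'K -srcE g'K.
- by move=> e; apply: (can_inj fK); rewrite f'K -tgtE g'K.
Qed.

Lemma digraph_iso_trans D1 D2 D3 :
  digraph_iso D1 D2 -> digraph_iso D2 D3 -> digraph_iso D1 D3.
Proof.
case=> f [g [bij_f bij_g srcE tgtE]] [f' [g' [bij_f' bij_g' srcE' tgtE']]].
exists (f' \o f), (g' \o g); split; try exact: bij_comp.
- by move=> e; rewrite /= srcE' srcE.
- by move=> e; rewrite /= tgtE' tgtE.
Qed.

Lemma nedges_iso D D' (f : vertex D -> vertex D') (g : edge D -> edge D') :
    injective f -> bijective g -> (forall e, src (g e) = f (src e)) ->
    (forall e, tgt (g e) = f (tgt e)) ->
  forall v w, nedges (f v) (f w) = nedges v w.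
Proof.
move=> f_inj g_bij srcE tgtE v w; rewrite !nedgesE (reindex g) /=;
  last exact: onW_bij.
by apply: eq_bigr => e _; rewrite srcE tgtE !(inj_eq f_inj).
Qed.

Lemma big_sig (R : Type) (idx : R) (op : Monoid.com_law idx) (I : finType)
    (P : pred I) (F : I -> R) :
  \big[op/idx]_(x : {x | P x}) F (val x) = \big[op/idx]_(x | P x) F x.
Proof.
rewrite [RHS](@reindex_omap _ _ _ _ {x | P x} val insub) => [|x Px];
  last by rewrite insubT.
by apply: eq_bigl => x; rewrite (valP x) valK eqxx.
Qed.

Section Preservation.
Variable C : numClosedFieldType.

(** An entry of L sums over the single vertex [tgt e], an entry of A over the edges from [v] to [w].
    Every claim about L is deduced from the one about A by means of this equality. *)
Lemma perm_Spec_L_A D :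
  perm_eq (nonzero_part (Spec_L C D)) (nonzero_part (Spec_A C D)).
Proof.
apply: (@eq_nonzero_eigenvalues_mul C _ _ _ _
  (fun (e : edge D) (v : vertex D) => (tgt e == v)%:R)
  (fun (v : vertex D) (e : edge D) => (src e == v)%:R)) => [e f|v w].
  rewrite (bigD1 (tgt e)) //= eqxx mul1r eq_sym big1 ?addr0; first by case: eqP.
  by move=> v; rewrite eq_sym => /negPf ->; rewrite mul0r.
rewrite nedgesE natr_sum; apply: eq_bigr => e _.
by rewrite -natrM mulnb.
Qed.

Lemma preserves_L_of_A cls m :
  preserves cls m (Spec_A C) -> preserves cls m (Spec_L C).
Proof.
move=> mA D D' clsD clsD' mDD'; rewrite (permPl (perm_Spec_L_A D)).
by rewrite (permPr (perm_Spec_L_A D')) mA.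
Qed.

Lemma does_not_preserve_L_of_A cls m :
  does_not_preserve cls m (Spec_A C) -> does_not_preserve cls m (Spec_L C).
Proof.
case=> D [D' [clsD clsD' mDD' nA]]; exists D, D'; split=> //; apply: contra nA.
by rewrite (permPl (perm_Spec_L_A D)) (permPr (perm_Spec_L_A D')).
Qed.

Section Embedding.
Variables (D D' : digraph) (h : vertex D' -> vertex D).
Hypothesis h_inj : injective h.

Section Adjacency.
Hypothesis nedges0 : forall v w, w \notin codom h -> nedges v w = 0%N.
Hypothesis nedgesh : forall v w, nedges v w = nedges (h v) (h w).

Lemma perm_Spec_A_embed :
  perm_eq (nonzero_part (Spec_A C D)) (nonzero_part (Spec_A C D')).
Proof.
apply: (eq_nonzero_eigenvalues_inj h_inj) => [v w /nedges0 -> //|v w].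
by rewrite nedgesh.
Qed.

Lemma perm_Spec_Ab_embed :
  perm_eq (nonzero_part (Spec_Ab C D)) (nonzero_part (Spec_Ab C D')).
Proof.
apply: (eq_nonzero_eigenvalues_inj h_inj) => [v w /nedges0 -> //|v w].
by rewrite nedgesh.
Qed.

End Adjacency.
End Embedding.

(** By antisymmetry, vanishing columns outside the image of [h] come with vanishing rows. Hence row
    sums are not changed by restricting to the image, and the Laplacian restricts along with the
    skew matrix. *)
Lemma perm_skew_spectra_embed (T U : finType) (N : T -> T -> nat) (M : U -> U ->
  nat)
    (h : U -> T) :
    injective h -> (forall t t', t' \notin codom h -> skew N t t' = 0) ->
    (forall u u', skew M u u' = skew N (h u) (h u')) ->
  let perm_nonzero (F : T -> T -> int) (G : U -> U -> int) :=
    perm_eq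
      (nonzero_part (eigenvalues (mx_of (fun t t' => (F t t')%:~R : C))))
      (nonzero_part (eigenvalues (mx_of (fun u u' => (G u u')%:~R : C)))) in
  perm_nonzero (skew N) (skew M) /\ perm_nonzero (skew_lap N) (skew_lap M).
Proof.
move=> h_inj skew0 skewh /=.
have skewN t t' : skew N t t' = - skew N t' t by rewrite /skew opprB.
split; apply: (eq_nonzero_eigenvalues_inj h_inj) => [t t' nht'|u u'].
- by rewrite skew0.
- by rewrite skewh.
- rewrite /skew_lap (skew0 _ t') // subr0; case: eqVneq => [->|_];
    last by rewrite mul0r.
  by rewrite big1 ?mulr0 // => x _; rewrite skewN skew0 ?oppr0.
rewrite /skew_lap skewh (inj_eq h_inj); congr (_ * _ - _)%:~R.
rewrite [RHS](bigID (mem (codom h))) /= [X in _ = _ + X]big1 ?addr0; last first.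
  by move=> t /skew0.
under eq_bigr do rewrite skewh.
have -> : \sum_u0 skew N (h u) (h u0) = \sum_(t <- codom h) skew N (h u) t.
  by rewrite big_map big_enum.
rewrite big_uniq /=; last by rewrite map_inj_uniq ?enum_uniq.
by apply: eq_bigl => t.
Qed.

Lemma digraph_iso_nedges D D' : digraph_iso D D' ->
  exists2 f : vertex D -> vertex D', bijective f
    & forall v w, nedges (f v) (f w) = nedges v w.
Proof.
case=> f [g [bij_f bij_g srcE tgtE]]; exists f => //.
exact: nedges_iso (bij_inj bij_f) bij_g srcE tgtE.
Qed.

Lemma bij_codom (T U : finType) (f : T -> U) : bijective f ->
  forall u, u \in codom f.
Proof. by case=> f' _ f'K u; apply/codomP; exists (f' u). Qed.

Lemma perm_Spec_A_iso D D' : digraph_iso D D' ->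
  perm_eq (nonzero_part (Spec_A C D')) (nonzero_part (Spec_A C D)).
Proof.
move=> /digraph_iso_nedges[f f_bij nedgesf];
  apply: (perm_Spec_A_embed (bij_inj f_bij)) => //.
by move=> v w /negP[]; apply: bij_codom.
Qed.

(** Only the deleted source lies outside the image, and no edge enters it; the edges that were
    deleted all start there, so multiplicities between the other vertices stay the same. *)
Lemma move_S_embed D D' : move_S D D' ->
  exists h : vertex D' -> vertex D, [/\ injective h,
    forall v w, w \notin codom h -> nedges v w = 0%N
    & forall v w, nedges v w = nedges (h v) (h w)].
Proof.
case=> v [sv [_ /digraph_iso_sym/digraph_iso_nedges[f f_bij nedgesf]]].
exists (val \o f); split.
- exact: inj_comp val_inj (bij_inj f_bij).
- move=> x w; have [->|nwv /negP[]] := eqVneq w v; last first.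
    case/codomP: (bij_codom f_bij (exist _ w nwv)) => y /(congr1 val) /= w_y.
    by apply/codomP; exists y.
  move=> _.
  rewrite nedgesE big1 // => e _; case: eqP => //= _.
  by rewrite (negPf (is_source_tgt e sv)).
move=> x w; rewrite -nedgesf !nedgesE /=.
rewrite (bigID (fun e => src e != v)) /= [X in (_ + X)%N]big1 ?addn0;
  last first.
  move=> e /negPn/eqP ->; rewrite eq_sym; case: eqP => // E.
  by have /eqP[] := valP (f x).
by rewrite -[RHS]big_sig.
Qed.

Lemma preserves_S_A cls : preserves cls move_S (Spec_A C).
Proof.
by move=> D D' _ _ /move_S_embed[h [h_inj h0 hE]];
  apply: (perm_Spec_A_embed h_inj).
Qed.

Lemma preserves_S_Ab cls : preserves cls move_S (Spec_Ab C).
Proof.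
by move=> D D' _ _ /move_S_embed[h [h_inj h0 hE]];
  apply: (perm_Spec_Ab_embed h_inj).
Qed.

End Preservation.

(** * Outsplitting *)

Section Outsplit.
Variables (D : digraph) (v : vertex D) (P : {set {set edge D}}).
Hypothesis hP : partition P (out_edges v).

Definition outsplit_merge (x : split_vertex v P) : vertex D :=
  if x is inl w then val w else v.

Lemma outsplit_srcP (e : edge D) :
  match outsplit_src hP e with
  | inl w => val w = src e
  | inr B => src e = v /\ val B = pblock P e
  end.
Proof.
rewrite /outsplit_src.
(* [outsplit_block] uses the proof found by [boolP], so only the index of
   [alt_spec] may be abstracted. *)
refine (match boolP (src e == v) as a in alt_spec _ _ b return
  match (match a with
    | AltTrue h => inr (exist _ (pblock P e) (outsplit_block hP h))
    | AltFalse h => inl (exist _ (src e) h)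
    end : split_vertex v P) with
  | inl w => val w = src e
  | inr B => src e = v /\ val B = pblock P e
  end with AltTrue h => _ | AltFalse h => _ end) => //=.
by split=> //; apply/eqP.
Qed.

Lemma outsplit_merge_src (e : edge D) : outsplit_merge (outsplit_src hP e) = src
  e.
Proof. by have := outsplit_srcP e; case: outsplit_src => [w|B [-> _]]. Qed.

(** An edge has exactly one copy ending in a given copy of its range, so only the source has to be
    tracked among the copies. *)
Lemma nedges_outsplit (x y : vertex (outsplit hP)) :
  nedges x y = (\sum_(e : edge D) ((outsplit_src hP e == x) && (tgt e ==
    outsplit_merge y)))%N.
Proof.
rewrite nedgesE big_sumType /=; case: y => [w|B] /=.
  rewrite [X in (_ + X)%N]big1 ?addn0 => [|[e B] _]; last by rewrite andbF.
  rewrite (bigID (fun e => tgt e != v)) /= [X in _ = (_ + X)%N]big1 ?addn0 =>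
    [|e].
    by rewrite -[RHS]big_sig.
  by case: w => w nwv /= /negPn/eqP ->; rewrite (eq_sym v) (negPf nwv) andbF.
rewrite big1 ?add0n => [|e _]; last by rewrite andbF.
rewrite [RHS](bigID (fun e => tgt e == v)) /= [X in _ = (_ + X)%N]big1 ?addn0 =>
  [|e /negPf ->]; last by rewrite andbF.
rewrite -[RHS]big_sig /=.
transitivity (\sum_(e : {e : edge D | tgt e == v}) \sum_(B' : {B | B \in P})
    ((outsplit_src hP (val e) == x) && (inr B' == inr B :> split_vertex v
      P)))%N.
  by rewrite pair_big; apply: eq_bigr => -[].
apply: eq_bigr => e _; rewrite (valP e) andbT (bigD1 B) //= eqxx andbT big1
  ?addn0 //.
by move=> B' nB; rewrite (inj_eq inr_inj) (negPf nB) andbF.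
Qed.
End Outsplit.

Section PreservationSplit.
Variable C : numClosedFieldType.

(** One factor records which copies lie over a vertex, the other counts the edges of [D] emitted by
    a copy. Summing over the copies of a vertex gives back A; pulling the range back to the copies
    gives the outsplit matrix. *)
Lemma perm_Spec_A_outsplit D (v : vertex D) P (hP : partition P (out_edges v)) :
  perm_eq (nonzero_part (Spec_A C D)) (nonzero_part (Spec_A C (outsplit hP))).
Proof.
apply: (@eq_nonzero_eigenvalues_mul C _ _ _ _
  (fun (w : vertex D) (x : vertex (outsplit hP)) => (outsplit_merge x == w)%:R)
  (fun x w => (\sum_(e : edge D) ((outsplit_src hP e == x) && (tgt e ==
    w)))%:R)).
  move=> w w'; rewrite nedgesE natr_sum.
  under [RHS]eq_bigr do rewrite -natrM big_distrr /=.
  rewrite -[RHS]natr_sum exchange_big /= [RHS]natr_sum; apply: eq_bigr => e _.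
  rewrite (bigD1 (outsplit_src hP e)) //= outsplit_merge_src eqxx /= mulnb.
  by rewrite big1 ?addn0 // => x /negPf; rewrite eq_sym => ->; rewrite muln0.
move=> x y; rewrite nedges_outsplit (bigD1 (outsplit_merge y)) //= eqxx mulr1.
rewrite [X in _ = _ + X]big1 ?addr0 // => w; rewrite eq_sym => /negPf ->;
  exact: mulr0.
Qed.

Lemma preserves_O_A cls : preserves cls move_O (Spec_A C).
Proof.
move=> D D' _ _ [v [P [hP [_ isoD']]]].
by rewrite (permPl (perm_Spec_A_outsplit hP)) perm_sym perm_Spec_A_iso.
Qed.

(** * Insplitting as outsplitting of the opposite digraph *)

Definition opposite (D : digraph) : digraph := Digraph (@tgt D) (@src D).

(** Both sides have the same vertex and edge types, so identities serve; the range maps differ only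
    in the membership proofs attached to the blocks. *)
Lemma insplit_opposite D (v : vertex D) P (hP : partition P (in_edges v)) :
  digraph_iso (opposite (@outsplit (opposite D) v P hP)) (insplit hP).
Proof.
exists id, id; split; try by exists id.
- by case=> [e|[e B]].
- have tgtE (e : edge D) : insplit_tgt hP e = @outsplit_src (opposite D) v P hP
    e.
    rewrite /insplit_tgt /outsplit_src.
    refine (match boolP (tgt e == v) as a in alt_spec _ _ b return
      (match a with
        | AltTrue h => inr (exist _ (pblock P e) (insplit_block hP h))
        | AltFalse h => inl (exist _ (tgt e) h)
        end : split_vertex v P) =
      match a with
        | AltTrue h => inr (exist _ (pblock P e)
            (outsplit_block (D := opposite D) hP h))
        | AltFalse h => inl (exist _ (tgt e) h)
        end with AltTrue h => _ | AltFalse h => _ end) => //=.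
    by congr inr; apply: val_inj.
  by case=> [e|[e B]]; apply: tgtE.
Qed.


(** Reversing the edges transposes A, which leaves the characteristic polynomial unchanged. *)
Lemma perm_Spec_A_opposite D :
  perm_eq (nonzero_part (Spec_A C (opposite D))) (nonzero_part (Spec_A C D)).
Proof.
apply: (@perm_nonzero_eigenvalues C _ _ _ _ 0 0); congr (_ * _).
rewrite -[RHS]det_tr; congr (\det _); apply/matrixP => i j; rewrite !mxE.
rewrite eq_sym; congr (_ *+ _ - (_%:R)%:P).
by rewrite /nedges setIC.
Qed.

Lemma preserves_I_A cls : preserves cls move_I (Spec_A C).
Proof.
move=> D D' _ _ [v [P [hP [_ _ isoD']]]].
rewrite (permPr (perm_Spec_A_iso C (digraph_iso_trans (insplit_opposite hP)
  isoD'))).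
rewrite (permPr (perm_Spec_A_opposite _)) -(permPl (perm_Spec_A_opposite _)).
exact: (@perm_Spec_A_outsplit (opposite D)).
Qed.

(** * The Cuntz splice *)

Section CuntzSplice.
Variables (D : digraph) (v : vertex D).
Local Notation D' := (cuntz_splice [set v]).

Definition splice_edge_rev (k : splice_edge) : splice_edge :=
  match k with
  | se1 => se2 | se2 => se1 | sf1 => sf1 | sf2 => sh1 | sh1 => sf2 | sh2 => sh2
  end.

Lemma splice_edge_revK : involutive splice_edge_rev.
Proof. by case. Qed.

Definition splice_weight (x y : vertex D') : nat :=
  (\sum_(p : {w | w \in [set v]} * splice_edge)
     ((splice_src p.1 p.2 == x) && (splice_tgt p.1 p.2 == y)))%N.

(** The six new edges are permuted by a reversal that exchanges [se1] with [se2] and [sf2] with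
    [sh1] and fixes the two loops. *)
Lemma splice_weightC x y : splice_weight x y = splice_weight y x.
Proof.
pose rev (p : {w | w \in [set v]} * splice_edge) := (p.1, splice_edge_rev p.2).
have revK : involutive rev by case=> w k; rewrite /rev /= splice_edge_revK.
rewrite /splice_weight (reindex_inj (inv_inj revK)) /=.
by apply: eq_bigr => -[w k] _; rewrite andbC; case: k.
Qed.

Lemma nedges_cuntz_splice (x y : vertex D') : nedges x y =
  match x, y with
  | inl a, inl b => nedges a b
  | _, _ => splice_weight x y
  end.
Proof.
rewrite nedgesE big_sumType /=.
have -> : (\sum_(i : {w | w \in [set v]} * splice_edge)
    ((let (w, k) := i in splice_src w k) == x) &&
    ((let (w, k) := i in splice_tgt w k) == y))%N = splice_weight x y.
  by apply: eq_bigr => -[].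
case: x y => [a|x] [b|y].
- rewrite [splice_weight _ _]big1 ?addn0 => [|[w k] _];
    first by rewrite nedgesE.
  by case: k; rewrite //= andbF.
- by rewrite big1 // => e _; rewrite andbF.
- by rewrite big1 // => e _.
- by rewrite big1 // => e _.
Qed.

End CuntzSplice.

Lemma move_C_embed D D' : move_C D D' ->
  exists h : vertex D -> vertex D', [/\ injective h,
    forall t t', t' \notin codom h ->
      skew (@nedges D') t t' = 0 /\ skew (@bedges D') t t' = 0
    & forall u u', skew (@nedges D) u u' = skew (@nedges D') (h u) (h u') /\
      skew (@bedges D) u u' = skew (@bedges D') (h u) (h u')].
Proof.
case=> v [_ _ /digraph_iso_nedges[f f_bij nedgesf]].
have [f' fK f'K] := f_bij.
exists (f \o inl); split.
- by apply: inj_comp (bij_inj f_bij) _ => a b [].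
- move=> t t' t'h; rewrite -(f'K t) -(f'K t') /skew /bedges !nedgesf.
  rewrite !nedges_cuntz_splice splice_weightC.
  (* A vertex outside the image is a new one, and all edges at it are splice edges, whose
     multiplicities are symmetric and cancel in [skew]. *)
  case: (f' t') (f'K t') => [a t'E|y _]; last by case: (f' t) => ?;
    rewrite !subrr.
  by case/negP: t'h; apply/codomP; exists a.
- by move=> u u'; rewrite /skew /bedges !nedgesf !nedges_cuntz_splice.
Qed.

Lemma preserves_C_skew cls X :
  List.In X [:: Spec_S C; Spec_Sb C; Spec_DeltaS C; Spec_DeltabS C] ->
  preserves cls move_C X.
Proof.
move=> inX D D' _ _ /move_C_embed[h [h_inj h0 hE]]; rewrite perm_sym.
have [pS pDS] := perm_skew_spectra_embed C h_inj (fun t t' H => (h0 t t' H).1)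
  (fun u u' => (hE u u').1).
have [pSb pDSb] := perm_skew_spectra_embed C h_inj (fun t t' H => (h0 t t' H).2)
  (fun u u' => (hE u u').2).
case: inX => [<-|[<-|[<-|[<-|[]]]]].
- rewrite /Spec_S !skew_adjacencyE. exact: pS.
- rewrite /Spec_Sb !bskew_adjacencyE; exact: pSb.
- rewrite /Spec_DeltaS !skew_laplacianE; exact: pDS.
- rewrite /Spec_DeltabS !bskew_laplacianE; exact: pDSb.
Qed.

End PreservationSplit.

(** * Strongly connected digraphs *)

Section StronglyConnected.
Variable D : digraph.
Hypothesis D_sc : strongly_connected D.

(** A path leading back from the range of an outgoing edge ends with an edge into [v]; if that path
    is empty, the outgoing edge is itself a loop. *)
Lemma strongly_connected_not_source (v : vertex D) : regular v ->
  ~~ is_source v.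
Proof.
move=> /set0Pn[e]; rewrite inE => /eqP sev.
have [p] := D_sc (tgt e) v; case: p => [/eqP tev|f p /and3P[_ _ tv]];
  apply/set0Pn; [exists e | exists (last f p)]; by rewrite inE ?tev.
Qed.

Lemma strongly_connected_no_move_S D' : ~ move_S D D'.
Proof.
by case=> v [sv [/strongly_connected_not_source/negP]].
Qed.

(** A path leading back to [v] is cut at its first arrival there. *)
Lemma return_path_from (v : vertex D) (e : edge D) :
  src e = v -> exists q, return_path v (e :: q).
Proof.
move=> sev; have [p p_v] := D_sc (tgt e) v.
suff [q [pth tq allq]] : exists q, [/\ path (@composable D) e q,
  tgt (last e q) == v
    & all (fun f => tgt f != v) (belast e q)].
  exists q; rewrite /= tq allq /is_cycle /= rcons_path pth /composable (eqP tq)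
    sev.
  by rewrite eqxx.
have [tev|ntev] := eqVneq (tgt e) v; first by exists [::]; rewrite /= tev eqxx.
case: p p_v => [/eqP|f p]; first by move=> tev; rewrite tev eqxx in ntev.
move=> /and3P[/eqP sf pth tv].
have {pth} : path (@composable D) e (f :: p) by rewrite /= pth /composable sf
  eqxx.
have {tv} : tgt (last e (f :: p)) == v by [].
elim: (f :: p) {sev sf} e ntev => [|g q IH] e ntev /=;
  first by rewrite (negPf ntev).
move=> tv /andP[eg pth].
have [tgv|ntgv] := eqVneq (tgt g) v.
  by exists [:: g]; rewrite /= eg tgv eqxx ntev.
have [q' [pth' tq' allq']] := IH g ntgv tv pth.
by exists (g :: q'); rewrite /= eg ntev.
Qed.

(** The exit of the loop starts a return path of its own, contradicting that the loop is the only
    one. *)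
Lemma strongly_connected_no_move_P D' : ~ move_P D D'.
Proof.
case=> v [l [[slv tlv] only_l [e [f [el nfe sfe]]] _ _]].
move: el nfe sfe; rewrite inE => /eqP -> /eqP nfl; rewrite slv => sfv.
by have [q /only_l[]] := return_path_from sfv.
Qed.

End StronglyConnected.

(** * Digraphs given by lists of edges *)

Lemma inj_surj_bij (T U : finType) (f : T -> U) :
  injective f -> (forall u, exists t, u = f t) -> bijective f.
Proof.
move=> f_inj f_surj; apply: (inj_card_bij f_inj).
rewrite -(card_codom f_inj); apply/subset_leq_card/subsetP => u _.
by apply/codomP.
Qed.

(* Vertex numbers in [es] are taken modulo [n.+1]. *)
Definition list_digraph (n : nat) (es : seq (nat * nat)) : digraph :=
  @Digraph 'I_n.+1 'I_(size es)
    (fun e => inZp (nth (0, 0)%N es e).1) (fun e => inZp (nth (0, 0)%N es e).2).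

(** Turns the identification of a concrete digraph into computation: it suffices to list vertices
    and edges exhaustively without repetition and to compare the table of endpoint positions. *)
Lemma list_digraph_iso n es D (sV : seq (vertex D)) (sE : seq (edge D)) :
    size sV = n.+1 -> uniq sV -> (forall v, v \in sV) ->
    uniq sE -> (forall e, e \in sE) ->
    [seq (index (src e) sV, index (tgt e) sV) | e <- sE] = es ->
  digraph_iso D (list_digraph n es).
Proof.
move=> szV uV inV uE inE def_es.
have szE : size es = size sE by rewrite -def_es size_map.
have ltE e : (index e sE < size es)%N by rewrite szE index_mem.
have ltV v : (index v sV < n.+1)%N by rewrite -szV index_mem.
have nthE e : nth (0, 0)%N es (index e sE) = (index (src e) sV,
  index (tgt e) sV).
  by rewrite -def_es (nth_map e) ?index_mem // nth_index.
exists (fun v => inZp (index v sV)), (fun e => Ordinal (ltE e)); split.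
- apply: inj_surj_bij => [v w /(congr1 val)|i] /=.
    by rewrite !modn_small // => /index_inj; apply.
  have x0 : vertex D by case: sV szV {uV inV ltV nthE def_es}.
  exists (nth x0 sV i); apply: val_inj.
  by rewrite /= index_uniq ?szV // modn_small.
- apply: inj_surj_bij => [e f /(congr1 val) /index_inj|i]; first exact.
  have x0 : edge D.
    by case: sE szE {uE inE def_es nthE ltE} => // sz0; move: (ltn_ord i);
      rewrite {2}sz0.
  by exists (nth x0 sE i); apply: val_inj; rewrite /= index_uniq // -szE.
- by move=> e; rewrite /= nthE.
- by move=> e; rewrite /= nthE.
Qed.

Lemma reachable_trans D (u v w : vertex D) :
  (exists p, path_between u p v) -> (exists p, path_between v p w) ->
  exists p, path_between u p w.
Proof.
move=> [p pp] [q qq]; exists (p ++ q).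
case: p pp => [/eqP -> //|e p] /and3P[ue pep pv] /=.
rewrite ue cat_path pep last_cat /=.
case: q qq => [/eqP <- //|f q] /and3P[vf pfq qw] /=.
by rewrite /composable (eqP pv) eq_sym vf pfq.
Qed.

(** The witness [c] is a closed walk through all vertices, repetitions allowed. Rotated to start at
    [v], it passes through [w] later on. *)
Lemma list_digraph_strongly_connected n (es : seq (nat * nat)) c :
    path.cycle (fun i j => (i, j) \in es) c ->
    all (fun i => i \in c) (iota 0 n.+1) ->
  strongly_connected (list_digraph n es).
Proof.
move=> c_cycle /allP all_c v w.
have in_c (i : 'I_n.+1) : val i \in c by apply: all_c; rewrite mem_iota ltn_ord.
have [k s def_c] := rot_to (in_c v).
have in_s : val w \in val v :: s by rewrite -def_c mem_rot.
have : path.cycle (fun i j => (i, j) \in es) (rot k c) by rewrite rot_cycle.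
rewrite def_c /= rcons_path => /andP[+ _].
suff: path (fun i j => (i, j) \in es) (val v) s ->
    exists p, @path_between (list_digraph n es) (inZp (val v)) p (inZp (val w)).
  by rewrite !valZpK.
elim: s {k def_c} (val v) in_s => [|y s IH] x /=.
  by rewrite inE => /eqP -> _; exists [::]; rewrite /= eqxx.
rewrite inE => /orP[/eqP -> _|in_s /andP[xy ys]].
  by exists [::]; rewrite /= eqxx.
apply: reachable_trans (IH y in_s ys).
have lt_xy : (index (x, y) es < size es)%N by rewrite index_mem.
by exists [:: Ordinal lt_xy]; rewrite /= nth_index // !eqxx.
Qed.

(* The outsplit at [v] along the partition of its outgoing edges into
   singletons, without sets of edges: the vertex [inr e] is the copy of [v]
   emitting [e], and the edge [(e, Some f)] is the copy of [e] with range
   [inr f]. *)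
Section FullOutsplit.
Variables (D : digraph) (v : vertex D).

Definition full_vertex (x : vertex D + edge D) : bool :=
  match x with inl w => w != v | inr e => src e == v end.

Definition full_edge (y : edge D * option (edge D)) : bool :=
  if y.2 is Some e then (tgt y.1 == v) && (src e == v) else tgt y.1 != v.

Definition full_src (e : edge D) : vertex D + edge D :=
  if src e == v then inr e else inl (src e).

Definition full_tgt (y : edge D * option (edge D)) : vertex D + edge D :=
  if y.2 is Some e then inr e else inl (tgt y.1).

Lemma full_srcP e : full_vertex (full_src e).
Proof. by rewrite /full_src; case: ifP => //= ->. Qed.

Lemma full_tgtP y : full_edge y -> full_vertex (full_tgt y).
Proof. by case: y => e [f|] //= /andP[]. Qed.

Definition full_outsplit : digraph :=
  @Digraph {x | full_vertex x} {y | full_edge y}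
    (fun y => exist _ (full_src (val y).1) (full_srcP (val y).1))
    (fun y => exist _ (full_tgt (val y)) (full_tgtP (valP y))).

Definition singletons : {set {set edge D}} := [set [set e] | e in out_edges v].

Lemma singletons_partition : partition singletons (out_edges v).
Proof.
apply/and3P; split.
- rewrite /cover big_imset /=; last by move=> e f _ _ /set1_inj.
  apply/eqP/setP => e; apply/bigcupP/idP => [[f vf /set1P -> //]|ve].
  by exists e; rewrite ?set11.
- apply/trivIsetP => _ _ /imsetP[e _ ->] /imsetP[f _ ->] nef.
  by rewrite disjoints1 inE; apply: contra nef => /eqP ->.
- by apply/imsetP => -[e _ /setP/(_ e)]; rewrite !inE eqxx.
Qed.

Lemma singletonsP e : src e == v -> [set e] \in singletons.
Proof. by move=> sev; apply: imset_f; rewrite inE. Qed.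

(** A singleton block is determined by its edge, so blocks can be replaced by edges. This allows the
    examples to be enumerated without finite sets. *)
Lemma full_outsplit_iso : digraph_iso full_outsplit (outsplit
  singletons_partition).
Proof.
pose f (x : vertex full_outsplit) : vertex (outsplit singletons_partition) :=
  match x with
  | exist (inl w) h => inl (exist _ w h)
  | exist (inr e) h => inr (exist _ [set e] (singletonsP h))
  end.
have andl b c : b && c -> b by case/andP.
have andr b c : b && c -> c by case/andP.
pose g (y : edge full_outsplit) : edge (outsplit singletons_partition) :=
  match y with
  | exist (e, None) h => inl (exist _ e h)
  | exist (e, Some e') h =>
      inr (exist _ e (andl _ _ h), exist _ [set e'] (singletonsP (andr _ _ h)))
  end.
exists f, g; split.
- apply: inj_surj_bij => [[[w|e] h] [[w'|e'] h'] //= []|[[w h]|[B BS]]].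
  + by move=> eqw; apply: val_inj; rewrite /= eqw.
  + by move=> /set1_inj eqe; apply: val_inj; rewrite /= eqe.
  + by exists (exist _ (inl w) h).
  case/imsetP: (BS) => e; rewrite inE => sev def_B.
  by exists (exist _ (inr e) sev); congr inr; apply: val_inj.
- apply: inj_surj_bij => [[[e [e'|]] h] [[d [d'|]] h'] //= []|[[e h]|[[e h] [B
    BS]]]].
  + by move=> eqe /set1_inj eqe'; apply: val_inj; rewrite /= eqe eqe'.
  + by move=> eqe; apply: val_inj; rewrite /= eqe.
  + by exists (exist _ (e, None) h).
  case/imsetP: (BS) => e'; rewrite inE => sev def_B.
  have ee' : full_edge (e, Some e') by rewrite /full_edge /= h.
  by exists (exist _ (e, Some e') ee'); congr (inr (_, _)); apply: val_inj.
- have srcE (e : edge D) : outsplit_src singletons_partition e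
      = f (exist _ (full_src e) (full_srcP e)).
    have := outsplit_srcP singletons_partition e.
    move: (full_srcP e); rewrite /full_src; case: eqVneq => [sev|nsev] /= h.
      case: outsplit_src => [[w nw] /= ww|[B BS] /= [_ def_B]].
        by case/negP: (nw); rewrite ww sev.
      congr inr; apply: val_inj; rewrite /= def_B.
      (* The block of the partition that contains [e] is the singleton of [e]. *)
      apply: def_pblock; rewrite ?inE ?singletonsP //.
      by case/and3P: singletons_partition.
    case: outsplit_src => [[w nw] /= ww|[B BS] /= [sev _]].
      by congr inl; apply: val_inj.
    by rewrite sev eqxx in nsev.
  by case=> [[e [e'|]] h]; apply: srcE.
- by case=> [[e [e'|]] h] /=; [congr inr | congr inl]; apply: val_inj.
Qed.

End FullOutsplit.

Lemma move_O_full D (v : vertex D) D' :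
  ~~ is_sink v -> digraph_iso (full_outsplit v) D' -> move_O D D'.
Proof.
move=> nsink iso; exists v, (singletons v), (singletons_partition v);
  split=> //.
exact: digraph_iso_trans (digraph_iso_sym (full_outsplit_iso v)) iso.
Qed.

Lemma opposite_iso D D' : digraph_iso D D' ->
  digraph_iso (opposite D) (opposite D').
Proof. by case=> f [g [? ? ? ?]]; exists f, g; split. Qed.

(** The edges into [v] are the edges out of [v] in the opposite digraph, so a singleton partition
    there is directly one for the insplit. *)
Lemma move_I_full D (v : vertex D) D' :
    regular v -> ~~ is_source v ->
    digraph_iso (opposite (@full_outsplit (opposite D) v)) D' ->
  move_I D D'.
Proof.
move=> reg nsource iso.
exists v, (@singletons (opposite D) v), (@singletons_partition (opposite D) v);
  split=> //.
apply: digraph_iso_trans iso.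
apply: digraph_iso_trans (digraph_iso_sym (insplit_opposite _)) _.
exact/opposite_iso/digraph_iso_sym/full_outsplit_iso.
Qed.

(** * Traces as integers that evaluate *)

Definition isum (n : nat) (f : nat -> int) : int :=
  foldr (fun i s => f i + s) 0 (iota 0 n).

Lemma sum_isum (n : nat) (f : nat -> int) : \sum_(i < n) f i = isum n f.
Proof. by rewrite -(big_mkord xpredT f) /isum unlock /index_iota subn0. Qed.

(** The trace is the sum of the squared entries of the incidence matrix; the column of an edge
    contains one 1 and one -1, or is zero for a loop. *)
Lemma trace_laplacian_edges (C : numClosedFieldType) D :
  \tr (laplacian C D) = 2 * \sum_(e : edge D) (src e != tgt e)%:R.
Proof.
rewrite /laplacian trmx_mx_of mx_of_mul trace_mx_of exchange_big mulr_sumr /=.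
apply: eq_bigr => e _; move: (src e) (tgt e) => a b.
have [->|nab] := eqVneq a b.
  by rewrite mulr0 big1 // => v _; rewrite andbN mulr0.
have nba : b != a by rewrite eq_sym.
rewrite (bigD1 a) //= eqxx nba /= mul1r mulr1.
rewrite (bigD1 b) //= (negPf nab) eqxx /= mulrNN mulr1 big1 ?addr0 //.
by move=> v /andP[]; rewrite !(eq_sym v) => /negPf -> /negPf ->; rewrite mulr0.
Qed.

Section Traces.
Variables (n : nat) (es : seq (nat * nat)).

(** The remainders match [inZp] in [list_digraph]. *)
Definition list_nedges (i j : nat) : nat :=
  count (fun p => (p.1 %% n.+1 == i) && (p.2 %% n.+1 == j))%N es.

Definition list_bedges (i j : nat) : nat := (0 < list_nedges i j)%N.

Definition list_weight (b : bool) := if b then list_bedges else list_nedges.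

Definition list_skew b (i j : nat) : int := (list_weight b i j)%:Z -
  (list_weight b j i)%:Z.

Definition tr_adj b := isum n.+1 (fun i => (list_weight b i i)%:Z).
Definition tr_sym b :=
  isum n.+1 (fun i => isum n.+1 (fun j => (list_weight b i j)%:Z * (list_weight
    b i j)%:Z)).
Definition tr_skew b :=
  isum n.+1 (fun i => isum n.+1 (fun j => list_skew b i j * list_skew b j i)).
(** The value given by [trace_skew_lap2]: squared degree differences plus the trace of the squared
    skew matrix. *)
Definition tr_skew_lap b :=
  isum n.+1 (fun i => isum n.+1 (list_skew b i) ^+ 2) + tr_skew b.
(** H is Hermitian with entries of modulus 0 or 1, so the trace of its square counts the ordered
    pairs joined in at least one direction. *)
Definition tr_herm2 :=
  isum n.+1 (fun i => isum n.+1 (fun j => (0 < list_weight false i j +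
    list_weight false j i)%N%:Z)).
Definition tr_lap : int :=
  (count (fun p => p.1 %% n.+1 != p.2 %% n.+1)%N es).*2%:Z.

Local Notation LD := (list_digraph n es).
Variable C : numClosedFieldType.

Lemma sum_edges_list_digraph (R : nmodType) (F : nat * nat -> R) :
  \sum_(e : edge LD) F (nth (0, 0)%N es e) = \sum_(p <- es) F p.
Proof. by rewrite (big_nth (0, 0)%N) big_mkord. Qed.

Lemma nedges_list_digraph (v w : vertex LD) : nedges v w = list_weight false v
  w.
Proof.
rewrite nedgesE /= /list_nedges -sum1_count [RHS]big_mkcond.
rewrite -[RHS](sum_edges_list_digraph (fun p => if ((p.1 %% n.+1 == v) && (p.2
  %% n.+1 == w))%N then 1 else 0)%N).
by apply: eq_bigr => e _; rewrite -!val_eqE /=; case: ifP.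
Qed.

Lemma bedges_list_digraph (v w : vertex LD) : bedges v w = list_weight true v w.
Proof. by rewrite /bedges nedges_list_digraph. Qed.

Lemma skew_list_digraph (v w : vertex LD) : skew (@nedges LD) v w = list_skew
  false v w.
Proof. by rewrite /skew !nedges_list_digraph. Qed.

Lemma bskew_list_digraph (v w : vertex LD) : skew (@bedges LD) v w = list_skew
  true v w.
Proof. by rewrite /skew !bedges_list_digraph. Qed.

Lemma trace_adjacency : \tr (adjacency C LD) = (tr_adj false)%:~R.
Proof.
rewrite trace_mx_of /tr_adj -sum_isum rmorph_sum; apply: eq_bigr => v _.
by rewrite nedges_list_digraph.
Qed.

Lemma trace_badjacency : \tr (badjacency C LD) = (tr_adj true)%:~R.
Proof.
rewrite badjacencyE trace_mx_of /tr_adj -sum_isum rmorph_sum;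
  apply: eq_bigr => v _.
by rewrite bedges_list_digraph.
Qed.

(** On the diagonal H has 1 at vertices with a loop and 0 elsewhere, as the binary adjacency matrix
    does. *)
Lemma trace_hermitian : \tr (hermitian_adjacency C LD) = (tr_adj true)%:~R.
Proof.
rewrite trace_mx_of /tr_adj -sum_isum rmorph_sum; apply: eq_bigr => v _.
by rewrite -bedges_list_digraph /bedges; case: (0 < _)%N.
Qed.

Lemma trace_hermitian2 :
  \tr (hermitian_adjacency C LD *m hermitian_adjacency C LD) = tr_herm2%:~R.
Proof.
rewrite mx_of_mul trace_mx_of /tr_herm2 -sum_isum rmorph_sum;
  apply: eq_bigr => v _.
rewrite -sum_isum rmorph_sum; apply: eq_bigr => w _.
rewrite -!nedges_list_digraph addn_gt0.
case: (0 < _)%N; case: (0 < _)%N => /=; rewrite ?mul0r ?mul1r //.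
- by rewrite mulrN mulCii opprK.
- by rewrite mulNr mulCii opprK.
Qed.

Lemma trace_sym_adjacency : \tr (adjacency C LD *m (adjacency C LD)^T) = (tr_sym
  false)%:~R.
Proof.
rewrite trmx_mx_of mx_of_mul trace_mx_of /tr_sym -sum_isum rmorph_sum;
  apply: eq_bigr => v _.
rewrite -sum_isum rmorph_sum; apply: eq_bigr => w _.
by rewrite rmorphM !nedges_list_digraph.
Qed.

Lemma trace_sym_badjacency : \tr (badjacency C LD *m (badjacency C LD)^T) =
  (tr_sym true)%:~R.
Proof.
rewrite badjacencyE trmx_mx_of mx_of_mul trace_mx_of /tr_sym -sum_isum
  rmorph_sum; apply: eq_bigr => v _.
rewrite -sum_isum rmorph_sum; apply: eq_bigr => w _.
by rewrite rmorphM !bedges_list_digraph.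
Qed.

Lemma trace_laplacian : \tr (laplacian C LD) = tr_lap%:~R.
Proof.
pose P (p : nat * nat) := (p.1 %% n.+1 != p.2 %% n.+1)%N.
rewrite trace_laplacian_edges /tr_lap -mul2n PoszM [RHS]rmorphM; congr (_ * _).
have -> : count P es = (\sum_(e : edge LD) P (nth (0, 0)%N es e))%N.
  rewrite (sum_edges_list_digraph (fun p => P p : nat)) -sum1_count big_mkcond.
  by apply: eq_bigr => p _; case: ifP.
rewrite [RHS]natr_sum; apply: eq_bigr => e _.
by rewrite -val_eqE.
Qed.

Lemma trace_skew2 :
  \tr (skew_adjacency C LD *m skew_adjacency C LD) = (tr_skew false)%:~R.
Proof.
rewrite skew_adjacencyE mx_of_mul trace_mx_of /tr_skew -sum_isum rmorph_sum;
  apply: eq_bigr => v _.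
rewrite -sum_isum rmorph_sum; apply: eq_bigr => w _.
by rewrite [RHS]rmorphM !skew_list_digraph.
Qed.

Lemma trace_bskew2 :
  \tr (bskew_adjacency C LD *m bskew_adjacency C LD) = (tr_skew true)%:~R.
Proof.
rewrite bskew_adjacencyE mx_of_mul trace_mx_of /tr_skew -sum_isum rmorph_sum;
  apply: eq_bigr => v _.
rewrite -sum_isum rmorph_sum; apply: eq_bigr => w _.
by rewrite [RHS]rmorphM !bskew_list_digraph.
Qed.

Lemma trace_skew_lap_mx (T : finType) (N : T -> T -> nat)
    (M := mx_of (fun v w => (skew_lap N v w)%:~R : C)) :
  \tr (M *m M) = (\sum_v (\sum_x skew N v x) ^+ 2
                  + \sum_v \sum_w skew N v w * skew N w v)%:~R.
Proof.
rewrite -trace_skew_lap2 mx_of_mul trace_mx_of rmorph_sum.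
apply: eq_bigr => v _; rewrite rmorph_sum.
by apply: eq_bigr => w _; rewrite rmorphM.
Qed.

Lemma trace_skew_laplacian2 :
  \tr (skew_laplacian C LD *m skew_laplacian C LD) = (tr_skew_lap false)%:~R.
Proof.
rewrite skew_laplacianE trace_skew_lap_mx; congr (_ + _)%:~R.
  rewrite -sum_isum; apply: eq_bigr => v _; rewrite -sum_isum; congr (_ ^+ 2).
  by apply: eq_bigr => w _; rewrite skew_list_digraph.
rewrite /tr_skew -sum_isum; apply: eq_bigr => v _; rewrite -sum_isum.
by apply: eq_bigr => w _; rewrite !skew_list_digraph.
Qed.

Lemma trace_bskew_laplacian2 :
  \tr (bskew_laplacian C LD *m bskew_laplacian C LD) = (tr_skew_lap true)%:~R.
Proof.
rewrite bskew_laplacianE trace_skew_lap_mx; congr (_ + _)%:~R.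
  rewrite -sum_isum; apply: eq_bigr => v _; rewrite -sum_isum; congr (_ ^+ 2).
  by apply: eq_bigr => w _; rewrite bskew_list_digraph.
rewrite /tr_skew -sum_isum; apply: eq_bigr => v _; rewrite -sum_isum.
by apply: eq_bigr => w _; rewrite !bskew_list_digraph.
Qed.

End Traces.

(** * Normalized and combinatorial Laplacians *)

Section Perron.
Variables (C : numClosedFieldType) (n : nat) (P : 'M[C]_n).
Hypothesis P_perron : exists phi, is_perron_vector P phi.

Lemma perron_vectorP : is_perron_vector P (perron_vector P).
Proof. exact: classical_sets.xgetPex. Qed.

(** The Perron vector has positive entries, so the two products are similar to [P] and to its
    transpose, and both have the trace of [P]. *)
Lemma trace_normalized_laplacian :
  \tr (normalized_laplacian P) = \sum_i (1 - P i i).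
Proof.
have [_ phi_gt0 _] := perron_vectorP.
have sqrtK : Phi_sqrtV P *m Phi_sqrt P = 1%:M.
  rewrite mulmx_diag -diag_const_mx; congr diag_mx; apply/rowP => i;
    rewrite !mxE.
  by rewrite mulVf // sqrtC_eq0 gt_eqF.
have sqrtVK : Phi_sqrt P *m Phi_sqrtV P = 1%:M by apply: mulmx1C.
have tr1 : \tr (Phi_sqrt P *m P *m Phi_sqrtV P) = \tr P.
  by rewrite mxtrace_mulC mulmxA sqrtK mul1mx.
have tr2 : \tr (Phi_sqrtV P *m P^T *m Phi_sqrt P) = \tr P.
  by rewrite mxtrace_mulC mulmxA sqrtVK mul1mx mxtrace_tr.
rewrite /normalized_laplacian linearB linearZ linearD /= tr1 tr2 mxtrace1.
by rewrite sumrB sumr_const card_ord -/(\tr P); field.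
Qed.

(** The two products in the definition are transposes of each other and thus have equal traces. *)
Lemma trace_combinatorial_laplacian :
  \tr (combinatorial_laplacian P) = \sum_i perron_vector P 0 i * (1 - P i i).
Proof.
rewrite /combinatorial_laplacian linearB linearZ linearD /=.
rewrite -[X in \tr (_^T *m X)]tr_diag_mx -trmx_mul mxtrace_tr -/(Phi P).
have -> : \tr (Phi P *m P) = \sum_i perron_vector P 0 i * P i i.
  by apply: eq_bigr => i _; rewrite mul_diag_mx mxE.
rewrite mxtrace_diag; under [RHS]eq_bigr do rewrite mulrBr mulr1.
by rewrite sumrB; field.
Qed.

End Perron.

Section Reversible.
Variables (C : numClosedFieldType) (T : finType) (W : T -> T -> nat) (t0 : T).
Hypothesis W_sym : forall t u, W t u = W u t.
Hypothesis W_gt0 : forall t, exists u, (0 < W t u)%N.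

Let d t := (\sum_u W t u)%N.
Let P : 'M[C]_#|T| := mx_of (fun t u => (W t u)%:R / (d t)%:R).

Lemma weight_le_degree t u : (W t u <= d t)%N.
Proof. by rewrite /d (bigD1 u) //= leq_addr. Qed.

Lemma degree_gt0 t : (0 < d t)%N.
Proof. by have [u /leq_trans] := W_gt0 t; apply; apply: weight_le_degree. Qed.

(* Detailed balance: the degrees form a stationary vector. *)
Lemma reversible_perron : exists phi, is_perron_vector P phi.
Proof.
pose s := (\sum_t d t)%N.
have s_gt0 : (0 < s)%N.
  by apply: leq_trans (degree_gt0 t0) _; rewrite /s (bigD1 t0) //= leq_addr.
exists (\row_i ((d (enum_val i))%:R / s%:R)); split.
- exists 1; rewrite scale1r; apply/rowP => j; rewrite !mxE.
  under eq_bigr do rewrite !mxE.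
  rewrite -(big_enum_val (fun t => (d t)%:R / s%:R * ((W t (enum_val j))%:R / (d
    t)%:R))) /=.
  under eq_bigr => t _.
    rewrite W_sym mulrAC mulrCA divff ?mulr1; last first.
      by rewrite pnatr_eq0 -lt0n degree_gt0.
    over.
  by rewrite -mulr_suml -natr_sum.
- by move=> i; rewrite mxE divr_gt0 ?ltr0n ?degree_gt0.
- under eq_bigr do rewrite mxE.
  rewrite -(big_enum_val (fun t => (d t)%:R / s%:R)) /=.
  by rewrite -mulr_suml -natr_sum divff // pnatr_eq0 -lt0n.
Qed.

Let trN := \tr (normalized_laplacian P).
Let trC := \tr (combinatorial_laplacian P).

(** With a single vertex all weight stays at it, so its transition probability is 1. *)
Lemma reversible_traces0 : (forall t, t = t0) -> trN = 0 /\ trC = 0.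
Proof.
move=> all_t0.
have P1 i : 1 - P i i = 0.
  rewrite mxE /d (bigD1 (enum_val i)) //= big1 ?addn0 => [|u].
    rewrite divff ?subrr // pnatr_eq0 -lt0n.
    by have [u] := W_gt0 (enum_val i);
      rewrite (all_t0 (enum_val i)) -(all_t0 u).
  by rewrite (all_t0 u) (all_t0 (enum_val i)) eqxx.
rewrite /trN /trC trace_normalized_laplacian ?trace_combinatorial_laplacian;
  try exact: reversible_perron.
by split; apply: big1 => i _; rewrite P1 ?mulr0.
Qed.

(** No diagonal entry of [P] exceeds 1, and the one at [t] is smaller because [u] takes a positive
    share. Perron weights are positive, so both sums are. *)
Lemma reversible_traces_gt0 t u : t != u -> (0 < W t u)%N -> 0 < trN /\ 0 < trC.
Proof.
move=> ntu Wtu.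
have d_gt0 s : 0 < (d s)%:R :> C by rewrite ltr0n degree_gt0.
have P_le1 i : 0 <= 1 - P i i.
  by rewrite mxE subr_ge0 ler_pdivrMr // mul1r ler_nat weight_le_degree.
have P_lt1 : 0 < 1 - P (enum_rank t) (enum_rank t).
  rewrite mxE enum_rankK subr_gt0 ltr_pdivrMr // mul1r ltr_nat.
  rewrite /d (bigD1 t) //= (bigD1 u) 1?eq_sym //= addnA.
  by rewrite (leq_trans _ (leq_addr _ _)) // -addn1 leq_add2l.
rewrite /trN /trC trace_normalized_laplacian ?trace_combinatorial_laplacian;
  try exact: reversible_perron.
have [_ phi_gt0 _] := perron_vectorP reversible_perron.
split; rewrite (bigD1 (enum_rank t)) //= ltr_wpDr ?mulr_gt0 //.
- exact: sumr_ge0.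
- by apply: sumr_ge0 => i _; rewrite mulr_ge0 // ltW.
Qed.

End Reversible.

Section DigraphTransition.
Variables (C : numClosedFieldType) (D : digraph).

Lemma transitionE : transition C D =
  mx_of (fun v w => (nedges v w)%:R / (\sum_x nedges v x)%N%:R).
Proof.
apply: eq_mx_of => v w; rewrite -outdegE; case: posnP => [->|//];
  exact/esym/mul0r.
Qed.

Lemma btransitionE : btransition C D =
  mx_of (fun v w => (bedges v w)%:R / (\sum_x bedges v x)%N%:R).
Proof.
apply: eq_mx_of => v w; rewrite -boutdegE /bedges; case: (0 < _)%N => /=.
  by rewrite mul1r.
by rewrite mul0r.
Qed.

End DigraphTransition.

(** * Separating spectra by power sums *)

Section Separation.
Variable C : numClosedFieldType.

Definition power_sum_on_lists (X : spectrum C) k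
    (inv : nat -> seq (nat * nat) -> int) : Prop :=
  forall n es, \sum_(z <- X (list_digraph n es)) z ^+ k.+1 = (inv n es)%:~R.

(** Equal nonzero parts have equal positive power sums, and in characteristic 0 distinct integers
    stay distinct in [C]. *)
Lemma power_sum_separates X k inv cls m n es n' es' :
    power_sum_on_lists X k inv -> inv n es != inv n' es' ->
    cls (list_digraph n es) -> cls (list_digraph n' es') ->
    m (list_digraph n es) (list_digraph n' es') ->
  does_not_preserve cls m X.
Proof.
move=> sumX neq_inv clsD clsD' mDD'.
exists (list_digraph n es), (list_digraph n' es'); split=> //.
apply: contra neq_inv => eqX; rewrite -(eqr_int C) -!sumX.
by rewrite -[X in X == _]sum_nonzero_part (perm_big _ eqX) sum_nonzero_part.
Qed.

Lemma sum1_eigenvalues n (M : 'M[C]_n) :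
  \sum_(z <- eigenvalues M) z ^+ 1 = \tr M.
Proof. exact: sum_eigenvalues. Qed.

Lemma power_sum_A :
  power_sum_on_lists (Spec_A C) 0 (fun n es => tr_adj n es false).
Proof. by move=> n es; rewrite sum1_eigenvalues trace_adjacency. Qed.

Lemma power_sum_Ab :
  power_sum_on_lists (Spec_Ab C) 0 (fun n es => tr_adj n es true).
Proof. by move=> n es; rewrite sum1_eigenvalues trace_badjacency. Qed.

Lemma power_sum_H :
  power_sum_on_lists (Spec_H C) 0 (fun n es => tr_adj n es true).
Proof. by move=> n es; rewrite sum1_eigenvalues trace_hermitian. Qed.

Lemma power_sum_H2 : power_sum_on_lists (Spec_H C) 1 tr_herm2.
Proof. by move=> n es; rewrite sum_eigenvalues2 trace_hermitian2. Qed.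

Lemma power_sum_symA :
  power_sum_on_lists (Spec_symA C) 0 (fun n es => tr_sym n es false).
Proof. by move=> n es; rewrite sum1_eigenvalues trace_sym_adjacency. Qed.

Lemma power_sum_symAb :
  power_sum_on_lists (Spec_symAb C) 0 (fun n es => tr_sym n es true).
Proof. by move=> n es; rewrite sum1_eigenvalues trace_sym_badjacency. Qed.

Lemma power_sum_Delta : power_sum_on_lists (Spec_Delta C) 0 tr_lap.
Proof. by move=> n es; rewrite sum1_eigenvalues trace_laplacian. Qed.

(** Second powers are taken for the four skew spectra because their first power sums are always 0:
    skew matrices have zero diagonal, and degree differences add up to 0. *)
Lemma power_sum_S :
  power_sum_on_lists (Spec_S C) 1 (fun n es => tr_skew n es false).
Proof. by move=> n es; rewrite sum_eigenvalues2 trace_skew2. Qed.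

Lemma power_sum_Sb :
  power_sum_on_lists (Spec_Sb C) 1 (fun n es => tr_skew n es true).
Proof. by move=> n es; rewrite sum_eigenvalues2 trace_bskew2. Qed.

Lemma power_sum_DeltaS :
  power_sum_on_lists (Spec_DeltaS C) 1 (fun n es => tr_skew_lap n es false).
Proof. by move=> n es; rewrite sum_eigenvalues2 trace_skew_laplacian2. Qed.

Lemma power_sum_DeltabS :
  power_sum_on_lists (Spec_DeltabS C) 1 (fun n es => tr_skew_lap n es true).
Proof. by move=> n es; rewrite sum_eigenvalues2 trace_bskew_laplacian2. Qed.

Definition normalized_spectra : seq (spectrum C) :=
  [:: Spec_DeltaN C; Spec_DeltabN C; Spec_DeltaC C; Spec_DeltabC C].

Section Symmetric.
Variables (D : digraph) (v0 : vertex D).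
Hypothesis D_sym : forall v w : vertex D, nedges v w = nedges w v.
Hypothesis D_gt0 : forall v : vertex D, exists w, (0 < nedges v w)%N.

Let bD_sym (v w : vertex D) : bedges v w = bedges w v.
Proof. by rewrite /bedges D_sym. Qed.

Let bD_gt0 (v : vertex D) : exists w, (0 < bedges v w)%N.
Proof. by have [w] := D_gt0 v; exists w; rewrite /bedges lt0b. Qed.

Lemma normalized_spectra_sum0 X : (forall v, v = v0) ->
  List.In X normalized_spectra -> \sum_(z <- X D) z = 0.
Proof.
move=> one; rewrite /= => inX.
have [trN trC] := reversible_traces0 C (t0 := v0) D_sym D_gt0 one.
have [trbN trbC] := reversible_traces0 C (t0 := v0) bD_sym bD_gt0 one.
case: inX => [<-|[<-|[<-|[<-|[]]]]];
  rewrite [LHS]sum_eigenvalues ?transitionE ?btransitionE;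
  [exact: trN | exact: trbN | exact: trC | exact: trbC].
Qed.

Lemma normalized_spectra_sum_gt0 X (v w : vertex D) :
  v != w -> (0 < nedges v w)%N ->
  List.In X normalized_spectra -> 0 < \sum_(z <- X D) z.
Proof.
move=> nvw vw; rewrite /= => inX.
have bvw : (0 < bedges v w)%N by rewrite /bedges vw.
have [trN trC] := reversible_traces_gt0 C v0 D_sym D_gt0 nvw vw.
have [trbN trbC] := reversible_traces_gt0 C v0 bD_sym bD_gt0 nvw bvw.
case: inX => [<-|[<-|[<-|[<-|[]]]]];
  rewrite sum_eigenvalues ?transitionE ?btransitionE;
  [exact: trN | exact: trbN | exact: trC | exact: trbC].
Qed.
End Symmetric.

Definition symmetric_lists n es : bool :=
  all (fun i => all (fun j => list_nedges n es i j == list_nedges n es j i)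
    (iota 0 n.+1)
             && has (fun j => 0 < list_nedges n es i j)%N (iota 0 n.+1)) (iota 0
               n.+1).

Lemma symmetric_listsP n es (D := list_digraph n es) : symmetric_lists n es ->
  (forall v w : vertex D, nedges v w = nedges w v) /\
  (forall v : vertex D, exists w, (0 < nedges v w)%N).
Proof.
move=> /allP sym_es.
have in_iota (i : 'I_n.+1) : val i \in iota 0 n.+1 by rewrite mem_iota ltn_ord.
split=> v => [w|]; have /andP[/allP sym_v /hasP[j]] := sym_es _ (in_iota v).
  by move=> _ _; rewrite !nedges_list_digraph; apply/eqP/sym_v/in_iota.
rewrite mem_iota => /= lt_j vj; exists (Ordinal lt_j).
by rewrite nedges_list_digraph.
Qed.

(** A one-vertex digraph has eigenvalue sum 0, a symmetric one with an edge from 0 to 1 a positive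
    sum. The disjunction admits moves that shrink the digraph as well as moves that enlarge it. *)
Lemma normalized_spectra_separated X cls m D D' es n es' :
    List.In X normalized_spectra ->
    symmetric_lists 0 es -> symmetric_lists n es' ->
      (0 < list_nedges n es' 0 1)%N ->
    (0 < n)%N ->
    (D = list_digraph 0 es /\ D' = list_digraph n es') \/
    (D' = list_digraph 0 es /\ D = list_digraph n es') ->
    cls D -> cls D' -> m D D' ->
  does_not_preserve cls m X.
Proof.
move=> inX /symmetric_listsP[sym sym_gt0] /symmetric_listsP[sym' sym'_gt0] e01
  n_gt0.
have one (v : 'I_1) : v = ord0 by rewrite ord1.
pose v0 : vertex (list_digraph n es') := inZp 0.
pose v1 : vertex (list_digraph n es') := inZp 1.
have ne01 : v0 != v1 by rewrite -val_eqE /= !modn_small.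
have v01 : (0 < nedges v0 v1)%N by rewrite nedges_list_digraph /= !modn_small.
have eq0 := @normalized_spectra_sum0 (list_digraph 0 es) ord0 sym sym_gt0 X one
  inX.
have gt0 := normalized_spectra_sum_gt0 v0 sym' sym'_gt0 ne01 v01 inX.
move=> DD' clsD clsD' mDD'; exists D, D'; split=> //; apply/negP => eqX.
suff eq_sum : \sum_(z <- X D) z = \sum_(z <- X D') z.
  case: DD' => -[DE D'E]; rewrite DE D'E eq0 in eq_sum.
    by rewrite -eq_sum ltxx in gt0.
  by rewrite eq_sum ltxx in gt0.
rewrite -[LHS](sum_nonzero_part _ 0) (perm_big _ eqX).
exact: (sum_nonzero_part _ 0).
Qed.

Lemma does_not_preserve_all cls m (X : spectrum C) :
  does_not_preserve cls m X -> does_not_preserve all_digraphs m X.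
Proof. by case=> D [D' [_ _ mDD' nX]]; exists D, D'. Qed.

End Separation.

(** * Counterexamples *)

Lemma reducibleI D (v u : vertex D) (f : edge D) :
    (forall e, (src e == v) = (e == f)) -> (exists e, tgt e == v) ->
    (forall e, tgt e == v -> src e = u) -> u != v ->
  reducible v u f.
Proof.
move=> out_v [e tev] in_v nuv; apply/and3P; split=> //.
  by apply/eqP/setP => e'; rewrite !inE out_v.
apply/eqP/setP => w; rewrite inE; apply/imsetP/eqP => [[e']|->].
  by rewrite inE => /in_v ->.
by exists e; rewrite ?inE // (in_v e).
Qed.

Lemma regularI D (v : vertex D) (e : edge D) : src e == v -> regular v.
Proof. by move=> sev; apply/set0Pn; exists e; rewrite inE. Qed.

Lemma not_sourceI D (v : vertex D) (e : edge D) : tgt e == v -> ~~ is_source v.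
Proof. by move=> tev; apply/set0Pn; exists e; rewrite inE. Qed.

Definition loop1 := [:: (0, 0)]%N.
Definition loops2 := [:: (0, 0); (0, 0)]%N.
Definition cycle2 := [:: (0, 1); (1, 0)]%N.
Definition cycle3 := [:: (0, 1); (1, 2); (2, 0)]%N.

Lemma move_R_cycle2 : move_R (list_digraph 1 cycle2) (list_digraph 0 loop1).
Proof.
pose D := list_digraph 1 cycle2.
pose e0 : edge D := Ordinal (isT : 0 < 2)%N.
pose e1 : edge D := Ordinal (isT : 1 < 2)%N.
have h : @reducible D (inZp 1) (inZp 0) e1.
  apply: reducibleI => //.
  - by case=> [[|[|//]] ?].
  - by exists e0.
  - by case=> [[|[|//]] ?] // _; apply: val_inj.
exists (inZp 1), (inZp 0), e1, h; split; first exact: (@regularI D _ e1).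
apply: (@list_digraph_iso _ _ (reduce h) [:: exist _ (inZp 0) isT] [:: inr
  (exist _ e0 isT)]) => //.
- by case=> [[[|[|//]] ?] ?].
- by case=> [[[[|[|//]] ?] ?]|[[[|[|//]] ?] ?]].
Qed.

(** Serves the skew spectra: the 2-cycle and the loop both have zero skew matrices, whereas the
    3-cycle does not. *)
Lemma move_R_cycle3 : move_R (list_digraph 2 cycle3) (list_digraph 1 cycle2).
Proof.
pose D := list_digraph 2 cycle3.
pose e0 : edge D := Ordinal (isT : 0 < 3)%N.
pose e1 : edge D := Ordinal (isT : 1 < 3)%N.
pose e2 : edge D := Ordinal (isT : 2 < 3)%N.
have h : @reducible D (inZp 1) (inZp 0) e1.
  apply: reducibleI => //.
  - by case=> [[|[|[|//]]] ?].
  - by exists e0.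
  - by case=> [[|[|[|//]]] ?] // _; apply: val_inj.
exists (inZp 1), (inZp 0), e1, h; split; first exact: (@regularI D _ e1).
apply: (@list_digraph_iso _ _ (reduce h) [:: exist _ (inZp 0) isT;
  exist _ (inZp 2) isT]
  [:: inr (exist _ e0 isT); inl (exist _ e2 isT)]) => //.
- by case=> [[[|[|[|//]]] ?] ?].
- by case=> [[[[|[|[|//]]] ?] ?]|[[[|[|[|//]]] ?] ?]].
Qed.

Definition complete2 := [:: (0, 0); (0, 1); (1, 0); (1, 1)]%N.
(** The golden mean digraph. Its adjacency matrix is symmetric, but after splitting vertex 1 the
    result is not, which separates the skew spectra; the double loop and [complete2] are both
    symmetric. *)
Definition golden := [:: (0, 1); (1, 0); (1, 1)]%N.
Definition golden_out := [:: (1, 0); (0, 1); (0, 2); (2, 1); (2, 2)]%N.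
Definition golden_in := [:: (1, 0); (2, 0); (1, 2); (2, 2); (0, 1)]%N.

Lemma move_O_loops2 : move_O (list_digraph 0 loops2) (list_digraph 1 complete2).
Proof.
pose D := list_digraph 0 loops2; pose v : vertex D := inZp 0.
pose e0 : edge D := Ordinal (isT : 0 < 2)%N;
  pose e1 : edge D := Ordinal (isT : 1 < 2)%N.
apply: (@move_O_full D v); first exact: (@regularI D _ e0).
apply: (@list_digraph_iso _ _ (full_outsplit v)
  [:: exist _ (inr e0) isT; exist _ (inr e1) isT]
  [:: exist _ (e0, Some e0) isT; exist _ (e0, Some e1) isT;
      exist _ (e1, Some e0) isT; exist _ (e1, Some e1) isT]) => //.
- by case=> [[[[|//] ?]|[[|[|//]] ?]] ?].
- by case=> [[[[|[|//]] ?] [[[|[|//]] ?]|]] ?].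
Qed.

Lemma move_I_loops2 : move_I (list_digraph 0 loops2) (list_digraph 1 complete2).
Proof.
pose D := list_digraph 0 loops2; pose v : vertex D := inZp 0.
pose e0 : edge D := Ordinal (isT : 0 < 2)%N;
  pose e1 : edge D := Ordinal (isT : 1 < 2)%N.
apply: (@move_I_full D v); first exact: (@regularI D _ e0).
  exact: (@not_sourceI D _ e0).
apply: (@list_digraph_iso _ _ (opposite (@full_outsplit (opposite D) v))
  [:: exist _ (inr e0) isT; exist _ (inr e1) isT]
  [:: exist _ (e0, Some e0) isT; exist _ (e1, Some e0) isT;
      exist _ (e0, Some e1) isT; exist _ (e1, Some e1) isT]) => //.
- by case=> [[[[|//] ?]|[[|[|//]] ?]] ?].
- by case=> [[[[|[|//]] ?] [[[|[|//]] ?]|]] ?].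
Qed.

Lemma move_O_golden : move_O (list_digraph 1 golden) (list_digraph 2
  golden_out).
Proof.
pose D := list_digraph 1 golden; pose v : vertex D := inZp 1.
pose e0 : edge D := Ordinal (isT : 0 < 3)%N;
  pose e1 : edge D := Ordinal (isT : 1 < 3)%N.
pose e2 : edge D := Ordinal (isT : 2 < 3)%N.
apply: (@move_O_full D v); first exact: (@regularI D _ e1).
apply: (@list_digraph_iso _ _ (full_outsplit v)
  [:: exist _ (inl (inZp 0)) isT; exist _ (inr e1) isT; exist _ (inr e2) isT]
  [:: exist _ (e1, None) isT; exist _ (e0, Some e1) isT;
      exist _ (e0, Some e2) isT; exist _ (e2, Some e1) isT;
        exist _ (e2, Some e2) isT]) => //.
- by case=> [[[[|[|//]] ?]|[[|[|[|//]]] ?]] ?].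
- by case=> [[[[|[|[|//]]] ?] [[[|[|[|//]]] ?]|]] ?].
Qed.

Lemma move_I_golden : move_I (list_digraph 1 golden) (list_digraph 2 golden_in).
Proof.
pose D := list_digraph 1 golden; pose v : vertex D := inZp 1.
pose e0 : edge D := Ordinal (isT : 0 < 3)%N;
  pose e1 : edge D := Ordinal (isT : 1 < 3)%N.
pose e2 : edge D := Ordinal (isT : 2 < 3)%N.
apply: (@move_I_full D v); first exact: (@regularI D _ e1).
  exact: (@not_sourceI D _ e0).
apply: (@list_digraph_iso _ _ (opposite (@full_outsplit (opposite D) v))
  [:: exist _ (inl (inZp 0)) isT; exist _ (inr e0) isT; exist _ (inr e2) isT]
  [:: exist _ (e1, Some e0) isT; exist _ (e1, Some e2) isT;
      exist _ (e2, Some e0) isT; exist _ (e2, Some e2) isT;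
        exist _ (e0, None) isT]) => //.
- by case=> [[[[|[|//]] ?]|[[|[|[|//]]] ?]] ?].
- by case=> [[[[|[|[|//]]] ?] [[[|[|[|//]]] ?]|]] ?].
Qed.

(** A single edge would not do, since its skew Laplacian is nilpotent. Here the degree differences
    2, -1, -1 give the squared skew Laplacian trace 6 - 4 = 2. *)
Definition fork := [:: (0, 1); (0, 2)]%N.

Lemma move_S_fork : move_S (list_digraph 2 fork) (list_digraph 1 [::]).
Proof.
pose D := list_digraph 2 fork; pose v : vertex D := inZp 0.
pose e0 : edge D := Ordinal (isT : 0 < 2)%N.
have sv : is_source v.
  by apply/set0Pn => -[[[|[|//]] ?]]; rewrite inE.
exists v, sv; split; first exact: (@regularI D _ e0).
apply: (@list_digraph_iso _ _ (remove_source sv)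
  [:: exist _ (inZp 1) isT; exist _ (inZp 2) isT] [::]) => //.
- by case=> [[[|[|[|//]]] ?] ?].
- by case=> [[[|[|//]] ?] ?].
Qed.

Lemma supports_twoI D (v : vertex D) (e f : edge D) : e != f ->
  src e == v -> tgt e == v -> src f == v -> tgt f == v ->
    supports_two_return_paths v.
Proof.
move=> nef /eqP se /eqP te /eqP sf /eqP tf; exists [:: e], [:: f].
rewrite /return_path /is_cycle /= /composable se te sf tf eqxx /=; split=> //.
by apply: contra nef => /eqP[->].
Qed.

Definition cuntz3 := [:: (0, 0); (0, 0); (0, 1); (1, 0); (1, 1); (1, 2); (2, 1);
  (2, 2)]%N.

Definition splice_edge_rank (k : splice_edge) : nat :=
  match k with se1 => 0 | se2 => 1 | sf1 => 2 | sf2 => 3 | sh1 => 4 | sh2 =>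
    5 end.

Lemma move_C_loops2 : move_C (list_digraph 0 loops2) (list_digraph 2 cuntz3).
Proof.
pose D := list_digraph 0 loops2; pose v : vertex D := inZp 0.
pose e0 : edge D := Ordinal (isT : 0 < 2)%N;
  pose e1 : edge D := Ordinal (isT : 1 < 2)%N.
exists v; split; [exact: (@regularI D _ e0) | exact: (@supports_twoI D _ e0 e1)
  |].
pose w : {w | w \in [set v]} := exist _ v (set11 v).
have all_w (w' : {w | w \in [set v]}) : w' = w by apply/val_inj/set1P/valP.
apply: (@list_digraph_iso _ _ (cuntz_splice [set v])
  [:: inl v; inr (w, su1); inr (w, su2)]
  [:: inl e0; inl e1; inr (w, se1); inr (w, se2); inr (w, sf1); inr (w, sf2);
      inr (w, sh1); inr (w, sh2)]) => //.
- case=> [[[|//] ?]|[w' []]] //; by rewrite (all_w w') !inE eqxx ?orbT.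
(* Equality of splice edges passes through [inord]; absence of repetitions is therefore checked on
   numeric keys, whose equality evaluates. *)
- pose key (e : edge (cuntz_splice [set v])) : nat + nat :=
    match e with inl e => inl (val e) | inr (_, k) =>
      inr (splice_edge_rank k) end.
  exact: (@map_uniq _ _ key).
- case=> [[[|[|//]] ?]|[w' []]] //; by rewrite (all_w w') !inE eqxx ?orbT.
Qed.

Definition loop_to_loops2 := [:: (0, 0); (0, 1); (1, 1); (1, 1)]%N.
(** Vertices 0 and 1 are the old ones, 2 and 3 the new vertices of the splice at 1; the last two
    entries are the additional edges from 0 to the second new vertex. *)
Definition eclosed4 := [:: (0, 0); (0, 1); (1, 1); (1, 1);
  (1, 2); (2, 1); (2, 2); (2, 3); (3, 2); (3, 3); (0, 3); (0, 3)]%N.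

(** The last edge of a return path must be [l]. In a longer one, the preceding edge would already
    end in [src l], which is [v]. *)
Lemma only_return_path D (v : vertex D) (l : edge D) :
    src l = v -> (forall e, tgt e == v -> e = l) ->
  forall p, return_path v p -> p = [:: l].
Proof.
move=> slv only_l [//|e q] /and3P[/andP[_]].
case/lastP: q => [|q f] /=; first by move=> _ /only_l ->.
rewrite last_rcons rcons_path => + /only_l def_f; rewrite {f}def_f.
rewrite rcons_path => /andP[/andP[_ q_l] _].
rewrite belast_rcons => /allP/(_ _ (mem_last e q)).
by rewrite (eqP q_l) slv eqxx.
Qed.

Lemma move_P_loops : move_P (list_digraph 1 loop_to_loops2) (list_digraph 3
  eclosed4).
Proof.
pose D := list_digraph 1 loop_to_loops2.
pose v : vertex D := inZp 0; pose w : vertex D := inZp 1.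
pose e0 : edge D := Ordinal (isT : 0 < 4)%N;
  pose e1 : edge D := Ordinal (isT : 1 < 4)%N.
pose e2 : edge D := Ordinal (isT : 2 < 4)%N;
  pose e3 : edge D := Ordinal (isT : 3 < 4)%N.
pose S : {set vertex D} := [set w' | (w' != v) && (0 < nedges v w')%N].
have wS : w \in S by rewrite inE nedges_list_digraph.
have Sw w' : w' \in S -> w' = w.
  by rewrite inE => /andP[]; case: w' => [[|[|//]] ?] // _ _; apply: val_inj.
exists v, e0; split; first by split; apply: val_inj.
- apply: only_return_path; first exact: val_inj.
  by case=> [[|[|[|[|//]]]] ?] // _; apply: val_inj.
- by exists e0, e1; split; rewrite ?inE //; apply: val_inj.
- move=> w' /Sw ->; split; first exact: (@regularI D _ e2).
  exact: (@supports_twoI D _ e2 e3).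
have all_w (w' : {w | w \in S}) : w' = exist _ w wS.
  by apply/val_inj/Sw/valP.
have e1S : (src e1 == v) && (tgt e1 \in S).
  by rewrite (_ : tgt e1 = w) ?wS //; apply: val_inj.
have all_e1 (f : {e : edge D | (src e == v) && (tgt e \in S)}) :
  f = exist _ e1 e1S.
  apply: val_inj; case: f => f /= /andP[sf /Sw tf].
  by case: f sf tf => [[|[|[|[|//]]]] ?] // _ _; apply: val_inj.
pose u : {w | w \in S} := exist _ w wS.
pose f1 : {e : edge D | (src e == v) && (tgt e \in S)} := exist _ e1 e1S.
apply: (@list_digraph_iso _ _ (eclose S v)
  [:: inl v; inl w; inr (u, su1); inr (u, su2)]
  [:: inl (inl e0); inl (inl e1); inl (inl e2); inl (inl e3);
      inl (inr (u, se1)); inl (inr (u, se2)); inl (inr (u, sf1));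
        inl (inr (u, sf2));
      inl (inr (u, sh1)); inl (inr (u, sh2)); inr (f1, true);
        inr (f1, false)]) => //.
- case=> [[[|[|//]] ?]|[w' []]] //; by rewrite (all_w w') !inE eqxx ?orbT.
- pose key (e : edge (eclose S v)) : nat + nat + bool :=
    match e with
    | inl (inl e) => inl (inl (val e))
    | inl (inr (_, k)) => inl (inr (splice_edge_rank k))
    | inr (_, b) => inr b
    end.
  exact: (@map_uniq _ _ key).
- case=> [[[[|[|[|[|//]]]] ?]|[w' []]]|[f []]] //.
  all: by rewrite ?(all_w w') ?(all_e1 f) !inE eqxx ?orbT.
Qed.

Section Counterexamples.
Variable C : numClosedFieldType.
Local Notation sc := strongly_connected.
Local Notation normalized := (normalized_spectra C).

Lemma sc_loop1 : sc (list_digraph 0 loop1).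
Proof. exact: (@list_digraph_strongly_connected _ _ [:: 0%N]). Qed.

Lemma sc_loops2 : sc (list_digraph 0 loops2).
Proof. exact: (@list_digraph_strongly_connected _ _ [:: 0%N]). Qed.

Lemma sc_cycle2 : sc (list_digraph 1 cycle2).
Proof. exact: (@list_digraph_strongly_connected _ _ [:: 0; 1]%N). Qed.

Lemma sc_cycle3 : sc (list_digraph 2 cycle3).
Proof. exact: (@list_digraph_strongly_connected _ _ [:: 0; 1; 2]%N). Qed.

Lemma sc_complete2 : sc (list_digraph 1 complete2).
Proof. exact: (@list_digraph_strongly_connected _ _ [:: 0; 1]%N). Qed.

Lemma sc_golden : sc (list_digraph 1 golden).
Proof. exact: (@list_digraph_strongly_connected _ _ [:: 0; 1]%N). Qed.

Lemma sc_golden_out : sc (list_digraph 2 golden_out).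
Proof. exact: (@list_digraph_strongly_connected _ _ [:: 0; 2; 1]%N). Qed.

Lemma sc_golden_in : sc (list_digraph 2 golden_in).
Proof. exact: (@list_digraph_strongly_connected _ _ [:: 0; 1; 2]%N). Qed.

Lemma sc_cuntz3 : sc (list_digraph 2 cuntz3).
Proof. exact: (@list_digraph_strongly_connected _ _ [:: 0; 1; 2; 1]%N). Qed.

Definition trace_spectra : seq (spectrum C) :=
  [:: Spec_A C; Spec_Ab C; Spec_Delta C; Spec_symA C; Spec_symAb C; Spec_H C].

Lemma trace_spectra_separated cls m n es n' es' X :
    cls (list_digraph n es) -> cls (list_digraph n' es') ->
    m (list_digraph n es) (list_digraph n' es') ->
    (forall b, tr_adj n es b != tr_adj n' es' b) ->
    (forall b, tr_sym n es b != tr_sym n' es' b) ->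
    tr_lap n es != tr_lap n' es' ->
  List.In X trace_spectra -> does_not_preserve cls m X.
Proof.
move=> clsD clsD' mDD' ne_adj ne_sym ne_lap.
have sep X' k inv ps ne :=
  @power_sum_separates C X' k inv _ _ _ _ _ _ ps ne clsD clsD' mDD'.
case=> [<-|[<-|[<-|[<-|[<-|[<-|[]]]]]]].
- exact: sep (@power_sum_A C) (ne_adj _).
- exact: sep (@power_sum_Ab C) (ne_adj _).
- exact: sep (@power_sum_Delta C) ne_lap.
- exact: sep (@power_sum_symA C) (ne_sym _).
- exact: sep (@power_sum_symAb C) (ne_sym _).
- exact: sep (@power_sum_H C) (ne_adj _).
Qed.

Lemma move_R_trace_spectra X :
  List.In X trace_spectra -> does_not_preserve sc move_R X.
Proof.
by apply: (trace_spectra_separated sc_cycle2 sc_loop1 move_R_cycle2); try case.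
Qed.

Lemma move_C_trace_spectra X :
  List.In X trace_spectra -> does_not_preserve sc move_C X.
Proof.
by apply: (trace_spectra_separated sc_loops2 sc_cuntz3 move_C_loops2); try case.
Qed.

Lemma move_P_trace_spectra X :
  List.In X trace_spectra -> does_not_preserve all_digraphs move_P X.
Proof.
by apply: (@trace_spectra_separated all_digraphs _ _ _ _ _ X I I move_P_loops);
  try case.
Qed.

Definition skew_spectra : seq (spectrum C) :=
  [:: Spec_S C; Spec_Sb C; Spec_DeltaS C; Spec_DeltabS C].

Lemma skew_spectra_separated cls m n es n' es' X :
    cls (list_digraph n es) -> cls (list_digraph n' es') ->
    m (list_digraph n es) (list_digraph n' es') ->
    (forall b, tr_skew n es b != tr_skew n' es' b) ->
    (forall b, tr_skew_lap n es b != tr_skew_lap n' es' b) ->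
  List.In X skew_spectra -> does_not_preserve cls m X.
Proof.
move=> clsD clsD' mDD' ne ne_lap.
have sep X' k inv ps ne' :=
  @power_sum_separates C X' k inv _ _ _ _ _ _ ps ne' clsD clsD' mDD'.
case=> [<-|[<-|[<-|[<-|[]]]]].
- exact: sep (@power_sum_S C) (ne _).
- exact: sep (@power_sum_Sb C) (ne _).
- exact: sep (@power_sum_DeltaS C) (ne_lap _).
- exact: sep (@power_sum_DeltabS C) (ne_lap _).
Qed.

Lemma move_R_skew_spectra X :
  List.In X skew_spectra -> does_not_preserve sc move_R X.
Proof.
by apply: (skew_spectra_separated sc_cycle3 sc_cycle2 move_R_cycle3); case.
Qed.

Lemma move_S_skew_spectra X :
  List.In X skew_spectra -> does_not_preserve all_digraphs move_S X.
Proof.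
by apply: (@skew_spectra_separated all_digraphs _ _ _ _ _ X I I move_S_fork);
  case.
Qed.

Lemma move_P_skew_spectra X :
  List.In X skew_spectra -> does_not_preserve all_digraphs move_P X.
Proof.
by apply: (@skew_spectra_separated all_digraphs _ _ _ _ _ X I I move_P_loops);
  case.
Qed.

Lemma move_O_skew_spectra X :
  List.In X skew_spectra -> does_not_preserve sc move_O X.
Proof.
by apply: (skew_spectra_separated sc_golden sc_golden_out move_O_golden); case.
Qed.

Lemma move_I_skew_spectra X :
  List.In X skew_spectra -> does_not_preserve sc move_I X.
Proof.
by apply: (skew_spectra_separated sc_golden sc_golden_in move_I_golden); case.
Qed.

Lemma move_S_spectra X :
  List.In X [:: Spec_Delta C; Spec_symA C; Spec_symAb C; Spec_H C] ->
  does_not_preserve all_digraphs move_S X.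
Proof.
have sep X' k inv ps ne :=
  @power_sum_separates C X' k inv all_digraphs _ _ _ _ _ ps ne I I move_S_fork.
case=> [<-|[<-|[<-|[<-|[]]]]].
- exact: sep (@power_sum_Delta C) isT.
- exact: sep (@power_sum_symA C) isT.
- exact: sep (@power_sum_symAb C) isT.
(* Neither digraph has loops, so the trace of H is 0 on both sides; the second power sums are 4 and
   0. *)
- exact: sep (@power_sum_H2 C) isT.
Qed.

Lemma move_O_spectra X :
  List.In X [:: Spec_Ab C; Spec_Delta C; Spec_symA C; Spec_symAb C; Spec_H C] ->
  does_not_preserve sc move_O X.
Proof.
have sep X' k inv ps ne :=
  @power_sum_separates C X' k inv _ _ _ _ _ _ ps ne sc_loops2 sc_complete2
    move_O_loops2.
case=> [<-|[<-|[<-|[<-|[<-|[]]]]]].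
- exact: sep (@power_sum_Ab C) isT.
- exact: sep (@power_sum_Delta C) isT.
(* The product of A with its transpose has trace 4 both for the double loop and for [complete2]; the
   golden pair gives 3 and 5. *)
- exact: (power_sum_separates (@power_sum_symA C) _ sc_golden sc_golden_out
    move_O_golden).
- exact: sep (@power_sum_symAb C) isT.
- exact: sep (@power_sum_H C) isT.
Qed.

Lemma move_I_spectra X :
  List.In X [:: Spec_Ab C; Spec_Delta C; Spec_symA C; Spec_symAb C; Spec_H C] ->
  does_not_preserve sc move_I X.
Proof.
have sep X' k inv ps ne :=
  @power_sum_separates C X' k inv _ _ _ _ _ _ ps ne sc_loops2 sc_complete2
    move_I_loops2.
case=> [<-|[<-|[<-|[<-|[<-|[]]]]]].
- exact: sep (@power_sum_Ab C) isT.
- exact: sep (@power_sum_Delta C) isT.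
(* As for the outsplit, the first pair has trace 4 on both sides and the golden pair gives 3 and
   5. *)
- exact: (power_sum_separates (@power_sum_symA C) _ sc_golden sc_golden_in
    move_I_golden).
- exact: sep (@power_sum_symAb C) isT.
- exact: sep (@power_sum_H C) isT.
Qed.

Lemma normalized_spectra_not_preserved X m :
  List.In m [:: move_R; move_O; move_I; move_C] ->
  List.In X normalized -> does_not_preserve sc m X.
Proof.
move=> inm inX.
have sep m' D D' es n es' := @normalized_spectra_separated C X sc m' D D' es n
  es' inX.
case: inm => [<-|[<-|[<-|[<-|[]]]]].
- by apply: (sep _ _ _ loop1 1%N cycle2 _ _ _ _ _ sc_cycle2 sc_loop1
    move_R_cycle2) => //; right.
- by apply: (sep _ _ _ loops2 1%N complete2 _ _ _ _ _ sc_loops2 sc_complete2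
    move_O_loops2) => //; left.
- by apply: (sep _ _ _ loops2 1%N complete2 _ _ _ _ _ sc_loops2 sc_complete2
    move_I_loops2) => //; left.
- by apply: (sep _ _ _ loops2 2%N cuntz3 _ _ _ _ _ sc_loops2 sc_cuntz3
    move_C_loops2) => //; left.
Qed.

Lemma in_cat_spectra (s1 s2 : seq (spectrum C)) X :
  List.In X (s1 ++ s2) -> List.In X s1 \/ List.In X s2.
Proof. exact: List.in_app_or. Qed.

Lemma move_R_not_preserved X :
  List.In X (trace_spectra ++ skew_spectra ++ normalized) ->
  does_not_preserve sc move_R X.
Proof.
case/in_cat_spectra => [|/in_cat_spectra[]].
- exact: move_R_trace_spectra.
- exact: move_R_skew_spectra.
- by apply: normalized_spectra_not_preserved; left.
Qed.

(** [behead] drops [Spec_A], which splittings preserve. *)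
Lemma move_O_not_preserved X :
  List.In X (behead trace_spectra ++ skew_spectra ++ normalized) ->
  does_not_preserve sc move_O X.
Proof.
case/in_cat_spectra => [|/in_cat_spectra[]].
- exact: move_O_spectra.
- exact: move_O_skew_spectra.
- by apply: normalized_spectra_not_preserved; right; left.
Qed.

Lemma move_I_not_preserved X :
  List.In X (behead trace_spectra ++ skew_spectra ++ normalized) ->
  does_not_preserve sc move_I X.
Proof.
case/in_cat_spectra => [|/in_cat_spectra[]].
- exact: move_I_spectra.
- exact: move_I_skew_spectra.
- by apply: normalized_spectra_not_preserved; right; right; left.
Qed.

Lemma move_C_not_preserved X :
  List.In X (trace_spectra ++ normalized) -> does_not_preserve sc move_C X.
Proof.
case/in_cat_spectra; first exact: move_C_trace_spectra.
by apply: normalized_spectra_not_preserved; right; right; right; left.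
Qed.

Lemma move_S_not_preserved X :
  List.In X ([:: Spec_Delta C; Spec_symA C; Spec_symAb C;
    Spec_H C] ++ skew_spectra) ->
  does_not_preserve all_digraphs move_S X.
Proof.
by case/in_cat_spectra; [exact: move_S_spectra | exact: move_S_skew_spectra].
Qed.

Lemma move_P_not_preserved X :
  List.In X (trace_spectra ++ skew_spectra) ->
  does_not_preserve all_digraphs move_P X.
Proof.
by case/in_cat_spectra; [exact: move_P_trace_spectra | exact:
  move_P_skew_spectra].
Qed.

End Counterexamples.

(** * Assembly of the claims *)

Ltac split_list H :=
  hnf in H; lazymatch type of H with
  | False => destruct H
  | _ => destruct H as [<- | H]; [ | split_list H]
  end.

Ltac in_list :=
  hnf; lazymatch goal with
  | |- ?x = ?x \/ _ => left; reflexivity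
  | |- _ => right; in_list
  end.

(** L is reduced to A first. Moves (S) and (P) have examples among all digraphs only; for the other
    moves, strongly connected examples settle both classes. *)
Ltac not_preserved :=
  lazymatch goal with
  | |- does_not_preserve _ _ (Spec_L _) =>
      apply: does_not_preserve_L_of_A; not_preserved
  | |- does_not_preserve all_digraphs move_S _ =>
      apply: move_S_not_preserved; in_list
  | |- does_not_preserve all_digraphs move_P _ =>
      apply: move_P_not_preserved; in_list
  | |- does_not_preserve all_digraphs _ _ =>
      apply: (does_not_preserve_all (cls := strongly_connected)); not_preserved
  | |- does_not_preserve _ move_R _ => apply: move_R_not_preserved; in_list
  | |- does_not_preserve _ move_O _ => apply: move_O_not_preserved; in_list
  | |- does_not_preserve _ move_I _ => apply: move_I_not_preserved; in_list
  | |- does_not_preserve _ move_C _ => apply: move_C_not_preserved; in_list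
  end.

Ltac none_preserved :=
  let m := fresh in let X := fresh in let inm := fresh in let inX := fresh in
  intros m X inm inX; split_list inm; split_list inX; not_preserved.


Theorem theorem1p1 (R : realType) :
  let C : numClosedFieldType := R[i] in
  (* A. All finite digraphs *)
  [/\ each_preserves all_digraphs [:: move_S; move_O; move_I] [:: Spec_A C]
      /\ none_preserves all_digraphs [:: move_R; move_C; move_P] [:: Spec_A C],
      each_preserves all_digraphs [:: move_S; move_O; move_I] [:: Spec_L C]
      /\ none_preserves all_digraphs [:: move_R; move_C; move_P] [:: Spec_L C],
      each_preserves all_digraphs [:: move_S] [:: Spec_Ab C]
      /\ none_preserves all_digraphs
           [:: move_R; move_O; move_I; move_C; move_P] [:: Spec_Ab C],
      each_preserves all_digraphs [:: move_C]
        [:: Spec_S C; Spec_Sb C; Spec_DeltaS C; Spec_DeltabS C]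
      /\ none_preserves all_digraphs
           [:: move_S; move_R; move_O; move_I; move_P]
           [:: Spec_S C; Spec_Sb C; Spec_DeltaS C; Spec_DeltabS C]
    & none_preserves all_digraphs
        [:: move_S; move_R; move_O; move_I; move_C; move_P]
        [:: Spec_Delta C; Spec_symA C; Spec_symAb C; Spec_H C]]
  /\
  (* B. Strongly connected finite digraphs *)
  [/\ forall D : digraph, strongly_connected D ->
        forall D' : digraph, ~ move_S D D' /\ ~ move_P D D',
      [/\ each_preserves strongly_connected [:: move_O; move_I] [:: Spec_A C]
          /\ none_preserves strongly_connected
               [:: move_R; move_C] [:: Spec_A C],
          each_preserves strongly_connected [:: move_O; move_I] [:: Spec_L C]
          /\ none_preserves strongly_connected
               [:: move_R; move_C] [:: Spec_L C],
          none_preserves strongly_connected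
            [:: move_R; move_O; move_I; move_C] [:: Spec_Ab C],
          each_preserves strongly_connected [:: move_C]
            [:: Spec_S C; Spec_Sb C; Spec_DeltaS C; Spec_DeltabS C]
          /\ none_preserves strongly_connected
               [:: move_R; move_O; move_I]
               [:: Spec_S C; Spec_Sb C; Spec_DeltaS C; Spec_DeltabS C]
        & none_preserves strongly_connected
            [:: move_R; move_O; move_I; move_C]
            [:: Spec_Delta C; Spec_symA C; Spec_symAb C; Spec_H C]]
    & none_preserves strongly_connected
        [:: move_R; move_O; move_I; move_C]
        [:: Spec_DeltaN C; Spec_DeltabN C; Spec_DeltaC C; Spec_DeltabC C]].
Proof.
move=> C.
(* Preservation for A, L and the skew spectra is established in an arbitrary class, so both halves
   of the theorem can draw on it. *)
have A_SOI cls : each_preserves cls [:: move_S; move_O; move_I] [:: Spec_A C].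
  move=> m X inm [<-|[]]; case: inm => [<-|[<-|[<-|[]]]];
  [exact: preserves_S_A | exact: preserves_O_A | exact: preserves_I_A].
have L_SOI cls : each_preserves cls [:: move_S; move_O; move_I] [:: Spec_L C].
  move=> m X inm [<-|[]]; apply: preserves_L_of_A.
  by apply: A_SOI => //; left.
have Ab_S : each_preserves all_digraphs [:: move_S] [:: Spec_Ab C].
  by move=> m X [<-|[]] [<-|[]]; exact: preserves_S_Ab.
have skew_C cls : each_preserves cls [:: move_C] (skew_spectra C).
  by move=> m X [<-|[]] inX; exact: preserves_C_skew.
split; split.
- by split=> //; none_preserved.
- by split=> //; none_preserved.
- by split=> //; none_preserved.
- by split=> //; none_preserved.
- by none_preserved.
- move=> D D_sc D'; split; first exact: strongly_connected_no_move_S.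
  exact: strongly_connected_no_move_P.
- split.
  (* Here [right] skips Move (S), the head of the longer list of moves. *)
  + by split; [move=> m X inm; apply: A_SOI; right | none_preserved].
  + by split; [move=> m X inm; apply: L_SOI; right | none_preserved].
  + by none_preserved.
  + by split=> //; none_preserved.
  + by none_preserved.
- by none_preserved.
Qed.
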